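(* Let $\beta=\frac12+\frac{\log(5/3)}{\log 4}$. (a) Let $F\in\mathrm{dom}\,\mathcal{E}$. Then $T_mF\in H^\beta(\mathrm{SG}_m)$ for all $m\ge0$ with uniformly bounded norms, and $$\sup_m\|T_mF\|_{H^\beta(\mathrm{SG}_m)}^2\le c\,\mathcal{E}(F).$$ (b) Let $f_m\in H^\beta(\mathrm{SG}_m)$, $m\ge 0$, be a sequence of functions with uniformly bounded norms satisfying the consistency condition $T_mf_{m'}=f_m$ whenever $m\le m'$. Then there exists $F\in\mathrm{dom}\,\mathcal{E}$ such that $T_mF=f_m$ for all $m$ and $$\mathcal{E}(F)\le c\sup_m\|f_m\|_{H^\beta(\mathrm{SG}_m)}^2 .$$ Here $c$ is a constant independent of $F$, $\{f_m\}$ and $m$.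
   Context: Let $q_0,q_1,q_2$ be the vertices of an equilateral triangle of side length $1$ in the plane, and $\Phi_i(x)=\frac12x+\frac12q_i$. The Sierpinski gasket $\mathrm{SG}$ is the unique nonempty compact set with $\mathrm{SG}=\bigcup_{i=0}^2\Phi_i(\mathrm{SG})$. For a word $w=(w_1,\dots,w_m)\in\{0,1,2\}^m$ write $|w|=m$ and $\Phi_w=\Phi_{w_1}\circ\cdots\circ\Phi_{w_m}$. For a function $f$ on $\mathrm{SG}$ let $E_m(f)=\sum_{i\ne j}\sum_{|w|=m}|f(\Phi_wq_i)-f(\Phi_wq_j)|^2$ and $\mathcal{E}(f)=\lim_{m\to\infty}(5/3)^mE_m(f)$ (the sequence is nondecreasing); $\mathrm{dom}\,\mathcal{E}$ is the space of functions (continuous on $\mathrm{SG}$) for which this limit is finite. $\mathrm{SG}_m$ is the metric graph whose vertices are the points $\Phi_wq_i$ ($|w|=m$) and whose edges are the segments $\Phi_w(e_{ij})$, $|w|=m$, where $e_{ij}$ is the side of the original triangle joining $q_i$ and $q_j$, each of length $2^{-m}$; these graphs are nested, $\mathrm{SG}_m\subset\mathrm{SG}_{m'}$ for $m\le m'$, and $T_m$ denotes restriction to $\mathrm{SG}_m$ (of functions on $\mathrm{SG}$ or on $\mathrm{SG}_{m'}$, $m'\ge m$). For a metric graph $G$ with edges $e$ of length $L_e$ parametrized by arclength $x\mapsto e(x)$, $H^\beta(G)$ is the space of continuous functions $F$ on $G$ (modulo constants) with $$\|F\|_{H^\beta(G)}^2=\sum_{e}\int_0^{L_e}\int_0^{L_e}\frac{|F(e(x))-F(e(y))|^2}{|x-y|^{1+2\beta}}\,dx\,dy<\infty.$$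 *)

(* Defs.v *)
From HB Require Import structures.
From mathcomp Require Import all_boot all_order all_algebra.
From mathcomp Require Import all_classical all_reals all_analysis.
Set Implicit Arguments. Unset Strict Implicit. Unset Printing Implicit Defensive.
Import Order.TTheory GRing.Theory Num.Theory.
Import numFieldNormedType.Exports.
Local Open Scope classical_set_scope.
Local Open Scope ring_scope.

Section SG.
Variable R : realType.

Definition pt := (R * R)%type.

Definition q (i : 'I_3) : pt :=
  match nat_of_ord i with
  | 0%N => (0, 0)
  | 1%N => (1, 0)
  | _ => (2^-1, Num.sqrt 3 / 2)
  end.

Definition Phi (i : 'I_3) (x : pt) : pt :=
  (2^-1 * x.1 + 2^-1 * (q i).1, 2^-1 * x.2 + 2^-1 * (q i).2).

Definition Phiw (m : nat) (w : m.-tuple 'I_3) : pt -> pt :=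
  foldr (fun i g => Phi i \o g) id w.

Definition Em (f : pt -> R) (m : nat) : R :=
  \sum_(i < 3) \sum_(j < 3 | i != j) \sum_(w : m.-tuple 'I_3)
     (f (Phiw w (q i)) - f (Phiw w (q j))) ^+ 2.

Definition Eseq (f : pt -> R) (m : nat) : R := (5 / 3) ^+ m * Em f m.

(* dom E : continuous on SG and the (nondecreasing) limit is finite *)
Definition domE (K : set pt) (f : pt -> R) : Prop :=
  {within K, continuous f} /\ cvg (Eseq f @ \oo).

Definition energy (f : pt -> R) : R := lim (Eseq f @ \oo).

(* arclength parametrisation of the edge Phi_w(e_ij) of SG_m, x in [0, 2^-m] *)
Definition edge (m : nat) (w : m.-tuple 'I_3) (i j : 'I_3) (x : R) : pt :=
  Phiw w ((q i).1 + (2 ^+ m * x) * ((q j).1 - (q i).1),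
          (q i).2 + (2 ^+ m * x) * ((q j).2 - (q i).2)).

Definition edgelen (m : nat) : R := (2 ^+ m)^-1.

Definition SGm (m : nat) : set pt :=
  [set p | exists (w : m.-tuple 'I_3) (i j : 'I_3), i != j /\
           exists2 x, 0 <= x <= edgelen m & p = edge w i j x].

Definition Iedge (m : nat) : set R := [set x : R | 0 <= x <= edgelen m].

Definition beta : R := 2^-1 + ln (5 / 3) / ln 4.

Definition Hnorm2 (m : nat) (F : pt -> R) : \bar R :=
  \sum_(i < 3) \sum_(j < 3 | (i < j)%N) \sum_(w : m.-tuple 'I_3)
    (\int[@lebesgue_measure R]_(x in Iedge m)
      \int[@lebesgue_measure R]_(y in Iedge m)
        ((F (edge w i j x) - F (edge w i j y)) ^+ 2
           / (`|x - y| `^ (1 + 2 * beta)))%R%:E)%E.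

Definition inH (m : nat) (F : pt -> R) : Prop :=
  {within SGm m, continuous F} /\ (Hnorm2 m F < +oo)%E.

Definition is_SG (K : set pt) : Prop :=
  compact K /\ K !=set0 /\ K = \bigcup_(i in [set: 'I_3]) (Phi i @` K).

End SG.

(* Main.v *)
(* On an edge of length L = 2^-m, [2 ^ (2 beta - 1) = 5 / 3] makes the H^beta
   seminorm of g comparable to sum_k (5/3)^(m+k) V_k, with V_k the sum of the
   squared increments of g over the 2^k dyadic subintervals: since 2 beta > 1,
   the oscillation on a dyadic interval is controlled by geometrically weighted
   increments inside it, and conversely an increment is controlled by chaining
   the averages of g over intervals shrinking to the endpoints.

   (a) Among the three subcells of a cell, the two along a given edge carry at
   most a fraction rho < 1 of the renormalized energy, up to a multiple of the
   energy gained in the refinement.  Iterating, the energies of the cells along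
   the edges of SG_m, at depth k, sum over k to at most a multiple of E(F).

   (b) The seminorm on SG_m bounds (5/3)^m E_m(f_m).  The increments of the
   common values at the vertices thus decay like (3/5)^(m/2), and since two cells
   of the same level that meet share a vertex, these values extend continuously
   to the gasket. *)

(* The obstacle in (a) is summability over the depth: at each single depth the cells along the edges
   carry at most the energy of [F], which gives no convergent series. The contraction cures this
   because its error terms, the gains [Eseq F n.+1 - Eseq F n], telescope. Its factor 29/30 leaves
   room above the harmonic value 14/15, and this room lets a finite multiple of the gain pay for the
   deviation from harmonicity.

   The chaining arguments use the weights [(4/3)^k]. The ratio has to exceed 1 for Cauchy-Schwarz
   and to stay below 5/3 for convergence against the scaling of the energy; the quotient is the
   ratio 4/5 of [geometric_sum_le].

   In (b) the extension is built from one value per cell rather than from the dense set of vertices.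
   A point is handled through any word that addresses it, and what must be controlled is the
   ambiguity of addresses; finite ramification enters there. Since [K] is known only through its
   fixed-point equation, both the inclusion of the segments and the intersections of cells are
   derived from that equation. *)
Require Import Defs.
From HB Require Import structures.
From mathcomp Require Import all_boot all_order all_algebra.
From mathcomp Require Import ring lra zify.
From mathcomp Require Import all_classical all_reals all_analysis.
From mathcomp Require Import measurable_realfun.
Import Order.TTheory GRing.Theory Num.Theory.
Import numFieldNormedType.Exports.
Local Open Scope classical_set_scope.
Local Open Scope ring_scope.
Set Implicit Arguments.
Unset Strict Implicit.
Unset Printing Implicit Defensive.

(** * The Gagliardo kernel on an interval *)

(** Cauchy-Schwarz against the weights [(3/4)^k], whose sum is 4. The induction peels off the first
    term, and the square of [3 * d 0 - S] is the slack. *)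
Lemma weighted_cauchy_schwarz (R : realFieldType) (d : nat -> R) (N : nat) :
  (\sum_(k < N) d k) ^+ 2 <= 4 * \sum_(k < N) (4 / 3) ^+ k * d k ^+ 2.
Proof.
elim: N d => [|N IH] d; first by rewrite !big_ord0 expr0n mulr0.
rewrite !big_ord_recl expr0 mul1r.
have := IH (fun k => d k.+1).
under [X in _ <= _ * (_ + X)]eq_bigr do rewrite lift0 exprS -mulrA.
rewrite -mulr_sumr; under [X in (_ + X) ^+ 2]eq_bigr do rewrite lift0.
set S := \sum_(i < N) d i.+1; set T := \sum_(i < N) _ * _ => h.
have := sqr_ge0 (3 * d 0%N - S); nra.
Qed.

Lemma sumr_double (V : nmodType) (f : nat -> V) (N : nat) :
  \sum_(l < N.*2) f l = \sum_(l < N) (f l.*2 + f l.*2.+1).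
Proof.
elim: N => [|N IH]; first by rewrite !big_ord0.
by rewrite doubleS 3!big_ord_recr /= IH addrA.
Qed.

Lemma sumr_block (V : nmodType) (f : nat -> V) (N M : nat) :
  \sum_(l < N) \sum_(k < M) f (l * M + k)%N = \sum_(l < N * M) f l.
Proof.
elim: N => [|N IH]; first by rewrite mul0n !big_ord0.
by rewrite big_ord_recr /= IH mulSnr big_split_ord.
Qed.

Section Kernel.
Variable R : realType.
Implicit Types (g : R -> R) (x y : R).
Local Notation mu := (@lebesgue_measure R).

(** The exponent is 2 + log(5/3)/log 2. In 20/3 = 4 * 5/3 the factor 4 cancels against the area of a
    dyadic square, and 5/3 is the energy scaling. *)
Lemma two_powR_dim : (2 : R) `^ (1 + 2 * beta R) = 20 / 3.
Proof.
have ln4 : ln 4 = ln 2 + ln 2 :> R.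
  by rewrite -lnM ?posrE//; congr ln; lra.
have ln2_gt0 : 0 < ln 2 :> R by apply: ln_gt0; lra.
rewrite /powR pnatr_eq0 /= /beta.
have -> : (1 + 2 * (2^-1 + ln (5 / 3) / ln 4)) * ln 2 =
    ln 2 + ln 2 + ln (5 / 3) :> R.
  by rewrite ln4; field; rewrite gt_eqF //; lra.
by rewrite !expRD !lnK ?posrE //; lra.
Qed.

Lemma edgelen_gt0 n : 0 < edgelen R n.
Proof. by rewrite invr_gt0 exprn_gt0. Qed.

Lemma edgelen_ge0 n : 0 <= edgelen R n.
Proof. exact: ltW (edgelen_gt0 n). Qed.

Lemma edgelenS n : edgelen R n.+1 = edgelen R n / 2.
Proof. by rewrite /edgelen exprSr invfM. Qed.

Lemma edgelenD m n : edgelen R (m + n) = edgelen R m * edgelen R n.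
Proof. by rewrite /edgelen exprD invfM. Qed.

Lemma edgelen_powR n : edgelen R n `^ (1 + 2 * beta R) = (3 / 20) ^+ n.
Proof.
have e0 : (2 : R)^-1 `^ (1 + 2 * beta R) = 3 / 20.
  have : (2 : R)^-1 `^ (1 + 2 * beta R) * 2 `^ (1 + 2 * beta R) = 1.
    by rewrite -powRM // ?invr_ge0 // mulVf ?pnatr_eq0 // powR1.
  by rewrite two_powR_dim => h; lra.
elim: n => [|n IH]; first by rewrite /edgelen !expr0 invr1 powR1.
by rewrite edgelenS powRM ?ltW ?edgelen_gt0 // IH e0 exprSr.
Qed.

Lemma beta_exponent_gt0 : 0 < 1 + 2 * beta R.
Proof.
have h (r : R) : 1 <= r -> 0 <= ln r by apply: ln_ge0.
rewrite /beta; have : 0 <= ln (5 / 3) / ln 4 :> R.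
  by rewrite divr_ge0 // h //; lra.
lra.
Qed.

Definition kern g x y : R := (g x - g y) ^+ 2 / `|x - y| `^ (1 + 2 * beta R).

Lemma kern_ge0 g x y : 0 <= kern g x y.
Proof. by rewrite divr_ge0 ?sqr_ge0 ?powR_ge0. Qed.

Lemma kern_le g n x y : edgelen R n <= `|x - y| ->
  kern g x y <= (20 / 3) ^+ n * (g x - g y) ^+ 2.
Proof.
move=> h; rewrite /kern mulrC ler_wpM2r ?sqr_ge0 //.
have e : (20 / 3) ^+ n = ((3 / 20) ^+ n)^-1 :> R.
  by rewrite -exprVn; congr (_ ^+ _); field.
rewrite e lef_pV2 ?posrE ?powR_gt0 ?exprn_gt0 //; last first.
- exact: lt_le_trans (edgelen_gt0 n) h.
- rewrite -edgelen_powR; apply: ge0_ler_powR => //; rewrite ?nnegrE //.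
  + exact: ltW beta_exponent_gt0.
  + exact: edgelen_ge0.
Qed.

Lemma kern_ge g n x y : `|x - y| <= edgelen R n ->
  (20 / 3) ^+ n * (g x - g y) ^+ 2 <= kern g x y.
Proof.
move=> h; have [->|xy] := eqVneq x y.
  by rewrite /kern !subrr expr0n /= mulr0 mul0r.
have e : (20 / 3) ^+ n = ((3 / 20) ^+ n)^-1 :> R.
  by rewrite -exprVn; congr (_ ^+ _); field.
rewrite /kern mulrC ler_wpM2l ?sqr_ge0 // e.
have xy0 : 0 < `|x - y| by rewrite normr_gt0 subr_eq0.
rewrite lef_pV2 ?posrE ?powR_gt0 ?exprn_gt0 //.
rewrite -edgelen_powR; apply: ge0_ler_powR => //; rewrite ?nnegrE //.
- exact: ltW beta_exponent_gt0.
- exact: edgelen_ge0.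
Qed.

Lemma IedgeE n : @Iedge R n = `[0, edgelen R n]%classic.
Proof. by apply/seteqP; split=> x; rewrite /Iedge /= in_itv. Qed.

(* No measurability is needed: the integral of a nonnegative function is a
   supremum over the simple functions below it. *)
Lemma ge0_le_integral_nonmeas (A D : set R) (f1 f2 : R -> \bar R) :
  A `<=` D -> (forall x, A x -> (0 <= f1 x)%E) ->
  (forall x, D x -> (0 <= f2 x)%E) -> (forall x, A x -> (f1 x <= f2 x)%E) ->
  (\int[mu]_(x in A) f1 x <= \int[mu]_(x in D) f2 x)%E.
Proof.
move=> AD f10 f20 f12; rewrite !ge0_integralE //.
apply: le_ereal_sup => _ [h hf <-]; exists h => // x.
apply: le_trans (hf x) _; rewrite /patch; case: ifPn => xA.
  by rewrite inE in xA; rewrite mem_set; [exact: f12|exact: AD].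
by case: ifPn => // xD; apply: f20; rewrite inE in xD.
Qed.

End Kernel.

Lemma within_continuous_cvg (T U : topologicalType) (A : set T) (f : T -> U)
    (u : nat -> T) (p : T) :
  {within A, continuous f} -> A p -> (forall n, A (u n)) ->
  u @ \oo --> p -> f (u n) @[n --> \oo] --> f p.
Proof.
move=> /subspace_continuousP cf Ap Au up; apply: (@cvg_comp _ _ _ u f _ (within A (nbhs p)));
  last exact: cf.
move=> B wB; have h : \forall n \near \oo, A (u n) -> B (u n) by exact: (up _ wB).
by apply: (@filterS _ \oo _ _ _ _ h) => n; apply; exact: Au.
Qed.

Lemma cvg_sqr_le (R : realType) (u : nat -> R) (a c T : R) :
  u @ \oo --> a -> (forall n, (u n - c) ^+ 2 <= T) -> (a - c) ^+ 2 <= T.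
Proof.
move=> ua uT; have dif_cvg : u n - c @[n --> \oo] --> a - c.
  by apply: cvgB => //; exact: cvg_cst.
have sq_cvg := cvgM dif_cvg dif_cvg.
refine (@cvgr_to_le _ _ _ R _ _ _ (sq_cvg _) _).
exact: nearW uT.
Qed.

Lemma geometric_sum_le (R : realFieldType) (K : nat) :
  \sum_(k < K) (4 / 5 : R) ^+ k <= 5.
Proof.
have -> : \sum_(k < K) (4 / 5 : R) ^+ k = 5 * (1 - (4 / 5) ^+ K).
  elim: K => [|K IH]; first by rewrite big_ord0 expr0 subrr mulr0.
  by rewrite big_ord_recr /= IH exprS; field.
have : 0 <= (4 / 5 : R) ^+ K by rewrite exprn_ge0 //; lra.
lra.
Qed.

(** * Dyadic chaining and the upper bound for the seminorm on an edge *)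

Section DyadicOscillation.
Variable R : realType.
Implicit Types (g : R -> R) (x y : R).
Local Notation mu := (@lebesgue_measure R).

Definition dyad N l : R := l%:R * edgelen R N.

Definition sqincr g N l : R := (g (dyad N l.+1) - g (dyad N l)) ^+ 2.

Lemma dyadD N k l : dyad (N + k) (l * 2 ^ k) = dyad N l.
Proof.
rewrite /dyad edgelenD natrM natrX /edgelen; field.
by rewrite !expf_neq0 // pnatr_eq0.
Qed.

Lemma dyad_double N l : dyad N.+1 l.*2 = dyad N l.
Proof. by rewrite -addn1 -(dyadD N 1) expn1 muln2. Qed.

Lemma ler_dyad N l k : (l <= k)%N -> dyad N l <= dyad N k.
Proof. by move=> lk; rewrite ler_wpM2r ?edgelen_ge0 // ler_nat. Qed.

Lemma le_dyad N l x : (dyad N l <= x) = (l%:R <= x * 2 ^+ N).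
Proof. by rewrite /dyad /edgelen ler_pdivrMr // exprn_gt0. Qed.

Lemma ge_dyad N l x : (x <= dyad N l) = (x * 2 ^+ N <= l%:R).
Proof. by rewrite /dyad /edgelen ler_pdivlMr // exprn_gt0. Qed.

Lemma cvg_edgelen : edgelen R n @[n --> \oo] --> (0 : R).
Proof.
have -> : edgelen R = fun n => (2^-1) ^+ n.
  by apply/funext => n; rewrite /edgelen exprVn.
by apply: cvg_expr; rewrite ger0_norm ?invr_ge0 //; lra.
Qed.

(** Chaining from the left end of the cell: [x] is the limit of its dyadic roundings, consecutive
    roundings agree or differ by one increment of the finer level, and [weighted_cauchy_schwarz]
    sums the steps. Each step is bounded by all the increments of its level inside the cell. *)
Lemma osc_dyadic_cell g N l x (T : R) :
  {within `[dyad N l, dyad N l.+1], continuous g} ->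
  dyad N l <= x <= dyad N l.+1 ->
  (forall K, \sum_(k < K) (4 / 3) ^+ k *
     (\sum_(j < 2 ^ k) sqincr g (N + k) (l * 2 ^ k + j)) <= T) ->
  (g x - g (dyad N l)) ^+ 2 <= 4 * T.
Proof.
move=> cg /andP[lx xl] hT.
have x0 : 0 <= x.
  by apply: le_trans lx; rewrite mulr_ge0 ?edgelen_ge0.
pose a k := Num.truncn (x * 2 ^+ (N + k)).
have aP k : (a k)%:R <= x * 2 ^+ (N + k) < (a k).+1%:R.
  by apply: truncn_itv; rewrite mulr_ge0 ?exprn_ge0.
have a_step k : (a k).*2 = a k.+1 \/ (a k).*2.+1 = a k.+1.
  have /andP[h1 h2] := aP k; have /andP[] := aP k.+1.
  rewrite addnS exprS mulrCA => h3 h4.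
  have : ((a k).*2 < (a k.+1).+1)%N by rewrite -(ltr_nat R) -muln2 natrM; lra.
  have : (a k.+1 < (a k).*2.+2)%N.
    by rewrite -(ltr_nat R) -doubleS -muln2 natrM; lra.
  lia.
have a_ge k : (l * 2 ^ k <= a k)%N.
  have /andP[h1 h2] := aP k; rewrite -ltnS -(ltr_nat R).
  by apply: le_lt_trans h2; rewrite -le_dyad dyadD.
(* Equality occurs when [x] is the right end of the cell; then [a 0 = l.+1], and the first term of
   the chain [d] below is the increment over the whole cell instead of 0. *)
have a_le k : (a k <= l.+1 * 2 ^ k)%N.
  have /andP[h1 h2] := aP k; rewrite -(ler_nat R).
  by apply: le_trans h1 _; rewrite -ge_dyad dyadD.
pose u k := dyad (N + k) (a k).
have uP k : u k <= x <= u k + edgelen R (N + k).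
  have /andP[h1 h2] := aP k; rewrite /u le_dyad h1 /=.
  have -> : dyad (N + k) (a k) + edgelen R (N + k) = dyad (N + k) (a k).+1.
    by rewrite /dyad -(natr1 (a k)) mulrDl mul1r.
  by rewrite ge_dyad ltW.
have u_cvg : u @ \oo --> x.
  apply: (@squeeze_cvgr _ _ _ _ (fun k => x - edgelen R (N + k)) (fun=> x)).
  - by apply: nearW => k; have /andP[h1 h2] := uP k; rewrite h1 lerBlDr h2.
  - rewrite -[X in _ --> X]subr0; apply: cvgB; first exact: cvg_cst.
    have -> : (fun k => edgelen R (N + k)) = [sequence edgelen R (k + N)]_k.
      by apply/funext => k; rewrite addnC.
    by rewrite cvg_shiftn; exact: cvg_edgelen.
  - exact: cvg_cst.
have u_in k : `[dyad N l, dyad N l.+1]%classic (u k).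
  rewrite /= in_itv /= -!(dyadD N k); apply/andP; split; exact: ler_dyad.
have gu : g (u k) @[k --> \oo] --> g x.
  by apply: within_continuous_cvg cg _ u_in u_cvg; rewrite /= in_itv /= lx.
have sqincr_le k j : (l * 2 ^ k <= j < l.+1 * 2 ^ k)%N ->
    sqincr g (N + k) j <= \sum_(j < 2 ^ k) sqincr g (N + k) (l * 2 ^ k + j).
  move=> /andP[h1 h2].
  have hj : (j - l * 2 ^ k < 2 ^ k)%N by rewrite ltn_subLR // -mulSnr.
  rewrite (bigD1 (Ordinal hj)) //= subnKC // lerDl.
  by apply: sumr_ge0 => i _; exact: sqr_ge0.
pose d k := if k is k'.+1 then g (u k'.+1) - g (u k') else g (u 0%N) - g (dyad N l).
have dsum K : \sum_(k < K.+1) d k = g (u K) - g (dyad N l).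
  elim: K => [|K IH]; first by rewrite big_ord_recl big_ord0 addr0.
  by rewrite big_ord_recr /= IH; ring.
have d_le k : d k ^+ 2 <= \sum_(j < 2 ^ k) sqincr g (N + k) (l * 2 ^ k + j).
  have v_ge0 : 0 <= \sum_(j < 2 ^ k) sqincr g (N + k) (l * 2 ^ k + j).
    by apply: sumr_ge0 => i _; exact: sqr_ge0.
  case: k v_ge0 => [|k] v_ge0 /=.
    have [e|ne] := eqVneq (a 0%N) l.
      have -> : u 0%N = dyad N l by rewrite /u e addn0.
      by rewrite subrr expr0n.
    have e : a 0%N = l.+1.
      by have := a_ge 0%N; have := a_le 0%N; rewrite expn0 !muln1; lia.
    have hl : (l * 2 ^ 0 <= l < l.+1 * 2 ^ 0)%N by rewrite !muln1 ltnS leqnn.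
    by apply: le_trans (sqincr_le 0%N l hl); rewrite /u e /sqincr addn0.
  have [e|e] := a_step k.
    have -> : u k.+1 = u k by rewrite /u -e addnS dyad_double.
    by rewrite subrr expr0n.
  have hl : (l * 2 ^ k.+1 <= (a k).*2 < l.+1 * 2 ^ k.+1)%N.
    by have := a_le k.+1; have := a_ge k; rewrite -e expnS; lia.
  apply: le_trans (sqincr_le k.+1 _ hl); rewrite /sqincr.
  have -> : u k.+1 = dyad (N + k.+1) (a k).*2.+1 by rewrite /u e.
  by have -> : u k = dyad (N + k.+1) (a k).*2 by rewrite /u addnS dyad_double.
have bound K : (g (u K) - g (dyad N l)) ^+ 2 <= 4 * T.
  rewrite -dsum; apply: le_trans (weighted_cauchy_schwarz _ _) _.
  rewrite ler_pM2l //; apply: le_trans (hT K.+1).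
  by apply: ler_sum => k _; rewrite ler_wpM2l // exprn_ge0.
by apply: cvg_sqr_le gu _ => K; exact: bound.
Qed.

End DyadicOscillation.

Section StepSeries.
Variable R : realType.
Implicit Types (g : R -> R) (x y : R).
Local Notation mu := (@lebesgue_measure R).

(** Blocks of two adjacent cells are used because two points of the edge at distance at most
    [2^-(m+n)] lie in a common one. The last block of a level sticks out of the edge, so the measure
    of its trace is only bounded by its full length. *)
Lemma integral_step_series m (f : R -> \bar R) (b : nat -> nat -> R) :
  (forall n l, 0 <= b n l) -> (forall x, Iedge m x -> (0 <= f x)%E) ->
  (forall x, Iedge m x -> (f x <= \sum_(n <oo)
    (\sum_(l < 2 ^ n)
      b n l * \1_(`[dyad R (m + n) l, dyad R (m + n) l.+2]%classic) x)%:E)%E) ->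
  (\int[mu]_(x in Iedge m) f x <=
   \sum_(n <oo) (\sum_(l < 2 ^ n) b n l * (2 * edgelen R (m + n)))%:E)%E.
Proof.
move=> b0 f0 fb.
have f20 x (Ix : Iedge m x) := le_trans (f0 x Ix) (fb x Ix).
apply: (le_trans (ge0_le_integral_nonmeas (fun _ => id) f0 f20 fb)).
have mD : measurable (@Iedge R m : set (measurableTypeR R)).
  by rewrite IedgeE; exact: measurable_itv.
pose J n l : set R := `[dyad R (m + n) l, dyad R (m + n) l.+2]%classic.
have mJ n l : measurable (J n l) by exact: measurable_itv.
have mb n l : measurable_fun (@Iedge R m : set (measurableTypeR R))
    (EFin \o (fun x : measurableTypeR R => b n l * \1_(J n l) x)).
  apply/measurable_EFinP; apply: measurable_funM; first exact: measurable_cst.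
  by apply: measurable_indic; exact: mJ.
have b1 n l x : (0 <= (b n l * \1_(J n l) x)%:E)%E.
  by rewrite lee_fin mulr_ge0.
rewrite integral_nneseries //; last first.
- move=> n x _; rewrite -sumEFin; apply: sume_ge0 => l _; exact: b1.
- by move=> n; under eq_fun do rewrite -sumEFin; apply: emeasurable_sum => l; exact: mb.
apply: lee_nneseries => n _.
  move=> _; apply: integral_ge0 => x _; rewrite -sumEFin.
  apply: sume_ge0 => l _; exact: b1.
under eq_integral => x _ do rewrite -sumEFin.
rewrite (@ge0_integral_sum _ _ _ _ _ mD _ (fun l : 'I_(2 ^ n) =>
  EFin \o (fun x => b n l * \1_(J n l) x))) //; last by move=> l x _; exact: b1.
rewrite -sumEFin; apply: lee_sum => l _ /=.
rewrite (@integralZl_indic _ _ _ _ _ mD (fun=> J n l) (b n l)); [|by rewrite ltNge b0|exact: mJ].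
rewrite integral_indic //; last exact: mJ.
rewrite EFinM; apply: lee_wpmul2l; first by rewrite lee_fin.
apply: (@le_trans _ _ (mu (J n l))).
  apply: le_measure; rewrite ?inE; [|exact: mJ|exact: subIsetl].
  by apply: measurableI; [exact: mJ|exact: mD].
rewrite /J lebesgue_measure_itv /= lte_fin; case: ifPn => _; last first.
  by rewrite lee_fin mulr_ge0 ?edgelen_ge0.
by rewrite -EFinD lee_fin /dyad -[l.+2]addn2 natrD; lra.
Qed.

End StepSeries.

Lemma cvg_sumr (R : realType) (I : Type) (r : seq I) (P : pred I)
    (F : I -> nat -> R) (a : I -> R) :
  (forall i, P i -> F i n @[n --> \oo] --> a i) ->
  \sum_(i <- r | P i) F i n @[n --> \oo] --> \sum_(i <- r | P i) a i.
Proof. by apply: cvg_big; exact: add_continuous. Qed.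

Section WeightedVariation.
Variables (R : realType) (g : R -> R) (m : nat) (B : R).
Implicit Types (x y : R).
Local Notation mu := (@lebesgue_measure R).
Hypothesis cg : {within Iedge m, continuous g}.

Definition variation n := \sum_(l < 2 ^ n) sqincr g (m + n) l.

Hypothesis sum_le : forall K, \sum_(k < K) (5 / 3) ^+ k * variation k <= B.

Definition local_variation n l k :=
  \sum_(j < 2 ^ k) sqincr g (m + n + k) (l * 2 ^ k + j).

Lemma variation_ge0 n : 0 <= variation n.
Proof. by apply: sumr_ge0 => l _; exact: sqr_ge0. Qed.

Lemma local_variation_ge0 n l k : 0 <= local_variation n l k.
Proof. by apply: sumr_ge0 => j _; exact: sqr_ge0. Qed.

Lemma sum_local_variation n k :
  \sum_(l < 2 ^ n) local_variation n l k = variation (n + k).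
Proof.
rewrite /local_variation /variation expnD addnA.
exact: (sumr_block (fun j => sqincr g (m + n + k) j)).
Qed.

Definition weighted_variation K n l :=
  \sum_(k < K) (4 / 3) ^+ k * local_variation n l k.

Lemma weighted_variation_term_ge0 n l k :
  0 <= (4 / 3) ^+ k * local_variation n l k.
Proof. by rewrite mulr_ge0 ?exprn_ge0 ?local_variation_ge0. Qed.

Lemma weighted_variation_ge0 K n l : 0 <= weighted_variation K n l.
Proof. by apply: sumr_ge0 => k _; exact: weighted_variation_term_ge0. Qed.

Lemma shifted_sum_le M k :
  \sum_(n < M) (5 / 3) ^+ (n + k) * variation (n + k) <= B.
Proof.
apply: le_trans (sum_le (k + M)); rewrite big_split_ord /= -[leLHS]add0r lerD //.
  by apply: sumr_ge0 => i _; rewrite mulr_ge0 ?variation_ge0 // exprn_ge0.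
by under eq_bigr do rewrite addnC.
Qed.

Lemma bound_ge0 : 0 <= B.
Proof. by apply: le_trans (sum_le 0); rewrite big_ord0. Qed.

(** Over the cells of level [n] the depth-[k] variations add up to [variation (n + k)], and
    [(5/3)^n (4/3)^k = (4/5)^k (5/3)^(n+k)]; the sum over [k] is geometric with total at most 5. *)
Lemma sum_weighted_variation_le M K :
  \sum_(n < M) (5 / 3) ^+ n * \sum_(l < 2 ^ n) weighted_variation K n l <= 5 * B.
Proof.
rewrite /weighted_variation.
under eq_bigr => n _.
  rewrite exchange_big /=; under eq_bigr do rewrite -mulr_sumr sum_local_variation.
  rewrite mulr_sumr; over.
rewrite exchange_big /=.
apply: (@le_trans _ _ (\sum_(k < K) (4 / 5) ^+ k * B)); last first.
  by rewrite -mulr_suml ler_wpM2r ?bound_ge0 ?geometric_sum_le.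
apply: ler_sum => k _.
apply: le_trans (ler_wpM2l _ (shifted_sum_le M k)); last by rewrite exprn_ge0.
rewrite mulr_sumr ler_sum // => n _; rewrite !mulrA ler_wpM2r ?variation_ge0 //.
have -> : (4 / 3) ^+ k = (4 / 5) ^+ k * (5 / 3) ^+ k :> R.
  by rewrite -exprMn; congr (_ ^+ _); field.
by rewrite exprD mulrCA.
Qed.

(* Extended by zero to [l >= 2 ^ n], where the cell leaves the edge. *)
Definition limit_variation n l : R :=
  if (l < 2 ^ n)%N then limn (fun K => weighted_variation K n l) else 0.

Lemma weighted_variation_nd n l :
  nondecreasing_seq (fun K => weighted_variation K n l).
Proof.
apply/nondecreasing_seqP => K; rewrite /weighted_variation big_ord_recr /= lerDl.
exact: weighted_variation_term_ge0.
Qed.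

(** A single pair [(n, l)] of the double sum bounded by [5 * B] dominates the partial sums, because
    its factor [(5/3)^n] is at least 1. *)
Lemma is_cvg_weighted_variation n l : (l < 2 ^ n)%N ->
  cvgn (fun K => weighted_variation K n l).
Proof.
move=> ln; apply: nondecreasing_is_cvgn (@weighted_variation_nd n l) _.
exists (5 * B) => _ [K _ <-]; apply: le_trans (sum_weighted_variation_le n.+1 K).
rewrite big_ord_recr /= -[leLHS]add0r; apply: lerD.
  apply: sumr_ge0 => i _; rewrite mulr_ge0 ?exprn_ge0 //.
  by apply: sumr_ge0 => j _; exact: weighted_variation_ge0.
apply: (@le_trans _ _ (\sum_(l < 2 ^ n) weighted_variation K n l)).
  rewrite (bigD1 (Ordinal ln)) //= lerDl; apply: sumr_ge0 => j _.
  exact: weighted_variation_ge0.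
rewrite ler_peMl //; last by rewrite exprn_ege1 //; lra.
by apply: sumr_ge0 => j _; exact: weighted_variation_ge0.
Qed.

Lemma weighted_variation_le_limit K n l : (l < 2 ^ n)%N ->
  weighted_variation K n l <= limit_variation n l.
Proof.
move=> ln; rewrite /limit_variation ln.
exact: (nondecreasing_cvgn_le (@weighted_variation_nd n l)
  (is_cvg_weighted_variation ln) K).
Qed.

Lemma limit_variation_ge0 n l : 0 <= limit_variation n l.
Proof.
rewrite /limit_variation; case: ifPn => // ln.
apply: limr_ge; first exact: is_cvg_weighted_variation.
by apply: nearW => K; exact: weighted_variation_ge0.
Qed.

Lemma sum_limit_variation_le M :
  \sum_(n < M) (5 / 3) ^+ n * \sum_(l < 2 ^ n) limit_variation n l <= 5 * B.
Proof.
have h : \sum_(n < M) (5 / 3) ^+ n * \sum_(l < 2 ^ n) weighted_variation K n l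
    @[K --> \oo] -->
    \sum_(n < M) (5 / 3) ^+ n * \sum_(l < 2 ^ n) limit_variation n l.
  apply: cvg_sumr => n _; apply: cvgMl_tmp.
  apply: cvg_sumr => l _; rewrite /limit_variation ltn_ord.
  exact: is_cvg_weighted_variation.
refine (cvgr_to_le h _); apply: nearW => K; exact: sum_weighted_variation_le.
Qed.

Lemma dyad_mem n l x : (l < 2 ^ n)%N ->
  dyad R (m + n) l <= x <= dyad R (m + n) l.+1 -> Iedge m x.
Proof.
move=> ln /andP[h1 h2]; apply/andP; split.
  by apply: le_trans h1; rewrite /dyad mulr_ge0 ?edgelen_ge0.
apply: le_trans h2 _; apply: (@le_trans _ _ (dyad R (m + n) (1 * 2 ^ n))).
  by rewrite mul1n; exact: ler_dyad.
by rewrite dyadD /dyad mul1r.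
Qed.

Lemma osc_le n l x : (l < 2 ^ n)%N ->
  dyad R (m + n) l <= x <= dyad R (m + n) l.+1 ->
  (g x - g (dyad R (m + n) l)) ^+ 2 <= 4 * limit_variation n l.
Proof.
move=> ln hx; apply: osc_dyadic_cell => //; last first.
  by move=> K; exact: weighted_variation_le_limit.
apply: continuous_subspaceW cg => y /=; rewrite in_itv /=; exact: dyad_mem.
Qed.

End WeightedVariation.

Section GagliardoUpper.
Variable R : realType.
Implicit Types (g : R -> R) (x y B : R).
Local Notation mu := (@lebesgue_measure R).

Lemma kernC g x y : kern g x y = kern g y x.
Proof. by rewrite /kern distrC -sqrrN opprB. Qed.

Lemma exists_dyadic_scale m x y : Iedge m x -> Iedge m y -> x != y ->
  exists n, edgelen R (m + n).+1 <= `|x - y| <= edgelen R (m + n).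
Proof.
move=> /andP[x0 x1] /andP[y0 y1] xy.
have d0 : 0 < `|x - y| by rewrite normr_gt0 subr_eq0.
have dL : `|x - y| <= edgelen R m by rewrite ler_norml; apply/andP; split; lra.
have ex : exists p, edgelen R (m + p).+1 <= `|x - y|.
  have /cvgr_lt/(_ _ d0)[p _ hp] := @cvg_edgelen R.
  by exists p; apply/ltW/hp => /=; lia.
case: (ex_minnP ex) => -[|p] hp pmin; first by exists 0%N; rewrite hp addn0.
exists p.+1; rewrite hp /=; have [//|h] := leP `|x - y| (edgelen R (m + p.+1)).
by have := pmin p; rewrite -addnS (ltW h) ltnn => /(_ isT).
Qed.

(** The scale is fixed by [2^-(m+n+1) <= |x - y| <= 2^-(m+n)], so the points lie in one cell or in
    two neighbours. In the worst case one dyadic point is crossed, which makes three increments: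
    with T for [limit_variation], [3 * 4 * (2 T_l + T_(l+1)) <= 24 * (T_l + T_(l+1))]. *)
Lemma kern_le_cell g m B :
  {within Iedge m, continuous g} ->
  (forall K, \sum_(k < K) (5 / 3) ^+ k * variation g m k <= B) ->
  forall x y, Iedge m x -> Iedge m y -> x != y ->
  exists n l, [/\ (l < 2 ^ n)%N,
    dyad R (m + n) l <= x <= dyad R (m + n) l.+2,
    dyad R (m + n) l <= y <= dyad R (m + n) l.+2 &
    kern g x y <= (20 / 3) ^+ (m + n).+1 *
      (24 * (limit_variation g m n l + limit_variation g m n l.+1))].
Proof.
move=> cg hB x y; wlog xy : x y / x < y.
  move=> hw Ix Iy ne; have [h|h|e] := ltgtP x y; first exact: hw h Ix Iy ne.
  - have [|n [l [h1 h2 h3 h4]]] := hw y x h Iy Ix; first by rewrite eq_sym.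
    by exists n, l; split => //; rewrite kernC.
  - by rewrite e eqxx in ne.
move=> Ix Iy ne; have [n /andP[nlo nup]] := exists_dyadic_scale Ix Iy ne.
move: nup; rewrite distrC gtr0_norm ?subr_gt0 // => nup.
have /andP[x0 x1] := Ix; have /andP[y0 y1] := Iy.
pose l := Num.truncn (x * 2 ^+ (m + n)).
have /andP[lx xl] : dyad R (m + n) l <= x < dyad R (m + n) l.+1.
  have := truncn_itv (_ : 0 <= x * 2 ^+ (m + n)).
  rewrite mulr_ge0 ?exprn_ge0 // -/l => /(_ isT) /andP[h1 h2].
  by rewrite le_dyad h1 /= ltNge le_dyad -ltNge.
have dS k : dyad R (m + n) k.+1 = dyad R (m + n) k + edgelen R (m + n).
  by rewrite /dyad -natr1 mulrDl mul1r.
have end_dyad : edgelen R m = dyad R (m + n) (2 ^ n).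
  by rewrite -[(2 ^ n)%N]mul1n dyadD /dyad mul1r.
have index_lt k z : dyad R (m + n) k < z -> z <= edgelen R m -> (k < 2 ^ n)%N.
  move=> h1 h2; rewrite ltnNge; apply/negP => /(@ler_dyad R (m + n)).
  by rewrite -end_dyad; lra.
have ln : (l < 2 ^ n)%N by apply: (index_lt _ y) => //; lra.
have osc := osc_le cg hB.
have Tge := limit_variation_ge0 hB.
exists n, l; split => //.
- by rewrite lx dS; have := edgelen_ge0 R (m + n); lra.
- by rewrite !dS; rewrite dS in xl; apply/andP; split; lra.
apply: le_trans (kern_le g nlo) _; rewrite ler_pM2l ?exprn_gt0 //.
have hx : (g x - g (dyad R (m + n) l)) ^+ 2 <= 4 * limit_variation g m n l.
  by apply: osc => //; lra.
have T0 := Tge n l; have T1 := Tge n l.+1.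
have [yl|yl] := leP y (dyad R (m + n) l.+1).
  have hy : (g y - g (dyad R (m + n) l)) ^+ 2 <= 4 * limit_variation g m n l.
    by apply: osc => //; lra.
  have := sqr_ge0 (g x + g y - 2 * g (dyad R (m + n) l)); nra.
have hm : (g (dyad R (m + n) l.+1) - g (dyad R (m + n) l)) ^+ 2 <=
    4 * limit_variation g m n l.
  by apply: osc => //; rewrite lexx ler_dyad.
have hy : (g y - g (dyad R (m + n) l.+1)) ^+ 2 <= 4 * limit_variation g m n l.+1.
  apply: osc; first exact: index_lt yl y1.
  by rewrite ltW //= !dS; rewrite dS in xl; lra.
move: hx hm hy.
set a := g x; set b := g (dyad R (m + n) l); set c := g (dyad R (m + n) l.+1).
set d := g y => hx hm hy.
have := sqr_ge0 ((a - b) + (c - b)); have := sqr_ge0 ((a - b) + (d - c)).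
have := sqr_ge0 ((c - b) - (d - c)); nra.
Qed.

Lemma integral_kern_le g m B :
  {within Iedge m, continuous g} ->
  (forall K, \sum_(k < K) (5 / 3) ^+ k * variation g m k <= B) ->
  (\int[mu]_(x in Iedge m) \int[mu]_(y in Iedge m) (kern g x y)%:E <=
   (6400 * (5 / 3) ^+ m * B)%:E)%E.
Proof.
move=> cg hB.
pose a n l := (20 / 3) ^+ (m + n).+1 *
      (24 * (limit_variation g m n l + limit_variation g m n l.+1)).
have Tge := limit_variation_ge0 hB.
have a0 n l : 0 <= a n l.
  by rewrite mulr_ge0 ?exprn_ge0 // mulr_ge0 // addr_ge0.
pose J n l : set R := `[dyad R (m + n) l, dyad R (m + n) l.+2]%classic.
have inner x : Iedge m x -> (\int[mu]_(y in Iedge m) (kern g x y)%:E <=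
    \sum_(n <oo) (\sum_(l < 2 ^ n) (a n l * (2 * edgelen R (m + n))) *
       \1_(J n l) x)%:E)%E.
  move=> Ix; pose b n l := a n l * \1_(J n l) x.
  have b0 n l : 0 <= b n l by rewrite mulr_ge0.
  have := @integral_step_series R m (fun y => (kern g x y)%:E) b b0 _ _.
  have -> : (\sum_(n <oo) (\sum_(l < 2 ^ n) b n l * (2 * edgelen R (m + n)))%:E)%E =
    (\sum_(n <oo) (\sum_(l < 2 ^ n) (a n l * (2 * edgelen R (m + n))) *
       \1_(J n l) x)%:E)%E.
    apply: eq_eseriesr => n _; congr EFin; apply: eq_bigr => l _.
    by rewrite /b mulrAC.
  apply; first by move=> y _; rewrite lee_fin kern_ge0.
  move=> y Iy.
  have t0 n : (0 <= (\sum_(l < 2 ^ n) b n l * \1_(J n l) y)%:E)%E.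
    by rewrite lee_fin; apply: sumr_ge0 => l _; rewrite mulr_ge0.
  have [->|xy] := eqVneq x y.
    rewrite /kern !subrr expr0n /= mul0r.
    by apply: nneseries_ge0 => n _ _; exact: t0.
  have [n [l [ln xJ yJ hk]]] := kern_le_cell cg hB Ix Iy xy.
  apply: (@le_trans _ _ (\sum_(l < 2 ^ n) b n l * \1_(J n l) y)%:E).
    rewrite lee_fin (bigD1 (Ordinal ln)) //=.
    have -> : b n l * \1_(J n l) y = a n l.
      by rewrite /b !indicE !mem_set ?mulr1 //= in_itv.
    rewrite -[leLHS]addr0; apply: lerD => //.
    by apply: sumr_ge0 => i _; rewrite mulr_ge0.
  have := @nneseries_lim_ge R (fun n => (\sum_(l < 2 ^ n) b n l * \1_(J n l) y)%:E)
    xpredT 0%N n.+1 (fun n _ _ => t0 n).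
  apply: le_trans; rewrite big_nat_recr //= -[leLHS]add0e.
  by apply: leeD2r; apply: sume_ge0 => i _; exact: t0.
pose b n l := a n l * (2 * edgelen R (m + n)).
have b0 n l : 0 <= b n l by rewrite mulr_ge0 // mulr_ge0 // edgelen_ge0.
apply: le_trans (@integral_step_series R m _ b b0 _ inner) _.
  by move=> x _; apply: integral_ge0 => y _; rewrite lee_fin kern_ge0.
apply: lime_le.
  apply: is_cvg_nneseries => n _ _; rewrite lee_fin; apply: sumr_ge0 => l _.
  by rewrite mulr_ge0 // mulr_ge0 // edgelen_ge0.
apply: nearW => M; rewrite sumEFin lee_fin big_mkord.
(* 1280 = 2 * 24 * (20/3) * 2^2: the two neighbouring cells, the oscillation constant, the extra
   power of 20/3, and the two block lengths. The factor 5 of [sum_limit_variation_le] then makes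
   6400. *)
apply: (@le_trans _ _ (\sum_(n < M) 1280 * (5 / 3) ^+ m *
   ((5 / 3) ^+ n * \sum_(l < 2 ^ n) limit_variation g m n l))); last first.
  rewrite -mulr_sumr.
  have -> : 6400 * (5 / 3) ^+ m * B = 1280 * (5 / 3) ^+ m * (5 * B) by ring.
  apply: ler_wpM2l; first by apply: mulr_ge0; [exact: ler0n|apply: exprn_ge0; lra].
  exact: (sum_limit_variation_le hB).
apply: ler_sum => n _.
(* The shifted sum loses the term at 0 and gains the value at [2 ^ n], which is 0 by convention. *)
have shift : \sum_(l < 2 ^ n) limit_variation g m n l.+1 <=
    \sum_(l < 2 ^ n) limit_variation g m n l.
  have [K eK] : exists K, (2 ^ n = K.+1)%N.
    by exists (2 ^ n).-1; rewrite prednK // expn_gt0.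
  have lastT : limit_variation g m n K.+1 = 0 by rewrite /limit_variation eK ltnn.
  rewrite eK big_ord_recr [leRHS]big_ord_recl /= lastT addr0.
  rewrite -[leLHS]add0r; apply: lerD; first exact: Tge.
  exact: ler_sum.
have cE : (20 / 3) ^+ (m + n).+1 * edgelen R (m + n) ^+ 2 =
    20 / 3 * ((5 / 3) ^+ m * (5 / 3) ^+ n).
  have e : (20 / 3) ^+ (m + n) = (5 / 3) ^+ (m + n) * (2 ^+ (m + n)) ^+ 2 :> R.
    by rewrite -exprM mulnC exprM -exprMn; congr (_ ^+ _); field.
  rewrite exprS e -exprD /edgelen; field.
  by rewrite expf_neq0 // pnatr_eq0.
have -> : \sum_(l < 2 ^ n) b n l * (2 * edgelen R (m + n)) =
    640 * ((5 / 3) ^+ m * (5 / 3) ^+ n) * (\sum_(l < 2 ^ n) limit_variation g m n l +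
      \sum_(l < 2 ^ n) limit_variation g m n l.+1).
  rewrite -big_split /= mulr_sumr; apply: eq_bigr => l _.
  set S := _ + _.
  have -> : b n l * (2 * edgelen R (m + n)) =
      96 * S * ((20 / 3) ^+ (m + n).+1 * edgelen R (m + n) ^+ 2).
    by rewrite /b /a -/S; ring.
  by rewrite cE; field.
have P0 : 0 <= (5 / 3) ^+ m * (5 / 3) ^+ n :> R by rewrite mulr_ge0 ?exprn_ge0.
move: shift; set X := \sum_(l < 2 ^ n) limit_variation g m n l.
set Y := \sum_(l < 2 ^ n) _ => shift.
have -> : 1280 * (5 / 3) ^+ m * ((5 / 3) ^+ n * X) =
    640 * ((5 / 3) ^+ m * (5 / 3) ^+ n) * (X + X) by ring.
apply: ler_wpM2l; first exact: mulr_ge0 (ler0n _ _) P0.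
exact: lerD.
Qed.

(** The series is kept as an extended real, so that the bound can be summed over the words before
    any single series is known to be finite. *)
Lemma integral_kern_le_series g m :
  {within Iedge m, continuous g} ->
  (\int[mu]_(x in Iedge m) \int[mu]_(y in Iedge m) (kern g x y)%:E <=
   (6400 * (5 / 3) ^+ m)%:E *
     \sum_(k <oo) ((5 / 3) ^+ k * variation g m k)%:E)%E.
Proof.
move=> cg; set S := (\sum_(k <oo) _)%E.
have t0 k : (0 <= ((5 / 3) ^+ k * variation g m k)%:E)%E.
  by rewrite lee_fin mulr_ge0 ?exprn_ge0 ?variation_ge0.
have S0 : (0 <= S)%E by apply: nneseries_ge0.
have c0 : 0 < 6400 * (5 / 3) ^+ m :> R by apply: mulr_gt0; [lra|apply: exprn_gt0; lra].
have [Sy|Sfin] := eqVneq S +oo%E.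
  by rewrite Sy gt0_muley ?lte_fin // leey.
have SE : S = (fine S)%:E by rewrite fineK // ge0_fin_numE // lt_neqAle Sfin leey.
rewrite SE -EFinM; apply: integral_kern_le => // K.
rewrite -lee_fin -SE -sumEFin -(big_mkord xpredT (fun k => ((5 / 3) ^+ k * variation g m k)%:E)).
exact: nneseries_lim_ge.
Qed.


End GagliardoUpper.

(** * Averages and the lower bound for the seminorm by endpoint values *)

Section Averages.
Variable R : realType.
Implicit Types (g : R -> R) (x y a b : R).
Local Notation mu := (@lebesgue_measure R).

Definition avg g a b : R := (b - a)^-1 * (\int[mu]_(x in `[a, b]) g x).

Lemma itv_length a b : a < b -> fine (mu `[a, b]%classic) = b - a.
Proof. by move=> ab; rewrite lebesgue_measure_itv /= lte_fin ab. Qed.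

Lemma itv_integrable g a b : {within `[a, b], continuous g} ->
  mu.-integrable `[a, b] (EFin \o g).
Proof. by move=> cg; apply: continuous_compact_integrable => //; exact: segment_compact. Qed.

Lemma itv_cst_integrable (c : R) a b : mu.-integrable `[a, b] (EFin \o (fun=> c)).
Proof. by apply: itv_integrable; apply: continuous_subspaceT => x; exact: cvg_cst. Qed.

Lemma within_affine g a b c (k : R) : {within `[a, b], continuous g} ->
  {within `[a, b], continuous (fun x => k * (g x - c))}.
Proof.
move=> cg x; apply: cvgMl_tmp; apply: cvgB; [exact: cg|exact: cvg_cst].
Qed.

Lemma integral_affine g a b c (k : R) : a < b -> {within `[a, b], continuous g} ->
  \int[mu]_(x in `[a, b]) (k * (g x - c)) = k * ((b - a) * (avg g a b - c)).
Proof.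
move=> ab cg; have mI : measurable (`[a, b]%classic : set (measurableTypeR R)).
  exact: measurable_itv.
have ic := itv_cst_integrable c a b; have ig := itv_integrable cg.
rewrite RintegralZl //; last first.
  have := itv_integrable (@within_affine g a b c 1 cg).
  by congr (_.-integrable _ _); apply/funext => x /=; rewrite mul1r.
rewrite RintegralB // Rintegral_cst // itv_length // /avg.
by congr (_ * _); rewrite [RHS]mulrBr mulVKf ?[c * _]mulrC // subr_eq0 gt_eqF.
Qed.

(** Jensen's inequality for the square, by the tangent line [z^2 >= 2 s z - s^2] at [z = g x - c],
    where [s] is the mean of [z]; the affine minorant integrates exactly to the left-hand side. *)
Lemma integral_sqr_ge g a b c (k : R) : a < b -> 0 <= k ->
  {within `[a, b], continuous g} ->
  ((k * ((b - a) * (avg g a b - c) ^+ 2))%:E <=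
   \int[mu]_(x in `[a, b]) (k * (g x - c) ^+ 2)%:E)%E.
Proof.
move=> ab k0 cg; pose s := avg g a b - c.
have mI : measurable (`[a, b]%classic : set (measurableTypeR R)).
  exact: measurable_itv.
have cl := @within_affine g a b (c + s / 2) (2 * k * s) cg.
have cq : {within `[a, b], continuous (fun x => k * (g x - c) ^+ 2)}.
  move=> x.
  apply: (@continuous_comp (subspace `[a, b]) R R g (fun z => k * (z - c) ^+ 2)).
    exact: cg.
  apply: cvgMl_tmp.
  apply: (@continuous_comp R R R (fun z => z - c) (fun z => z ^+ 2)).
    by apply: cvgB; [exact: cvg_id|exact: cvg_cst].
  exact: exprn_continuous.
have il := itv_integrable cl; have iq := itv_integrable cq.
have -> : k * ((b - a) * (avg g a b - c) ^+ 2) =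
    \int[mu]_(x in `[a, b]) (2 * k * s * (g x - (c + s / 2))).
  by rewrite integral_affine // -/s opprD addrA -/s; field.
rewrite fineK; last exact: integrable_fin_num.
apply: le_integral => // x _; rewrite lee_fin.
have := sqr_ge0 (g x - c - s); nra.
Qed.

Lemma avg_between g a b : a < b -> {within `[a, b], continuous g} ->
  exists x, exists y, [/\ a <= x <= b, a <= y <= b & g x <= avg g a b <= g y].
Proof.
move=> ab cg; have [x xI gx] := EVT_min (ltW ab) cg.
have [y yI gy] := EVT_max (ltW ab) cg; exists x, y.
rewrite !in_itv /= in xI yI; split=> //.
have mI : measurable (`[a, b]%classic : set (measurableTypeR R)).
  exact: measurable_itv.
have ba : 0 < b - a by rewrite subr_gt0.
rewrite /avg ler_pdivlMl // ler_pdivrMl // ![(b - a) * _]mulrC.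
rewrite -(itv_length ab) -!Rintegral_cst //.
by apply/andP; split; apply: le_Rintegral => //;
  by [exact: itv_cst_integrable|exact: itv_integrable|move=> t tI; exact: gx
     |move=> t tI; exact: gy].
Qed.

End Averages.

Section GagliardoLower.
Variable R : realType.
Implicit Types (g : R -> R) (x y : R).
Local Notation mu := (@lebesgue_measure R).

(** Jensen twice: in [y] over [[a, b]], which replaces [g y] by the average, then in [x] over the
    half-length interval. There the kernel is at least [(20/3)^N] times the squared difference, and
    multiplied by the two lengths this factor becomes [(5/3)^N / 2]. *)
Lemma avg_step g m N (a b a' b' j : R) :
  {within Iedge m, continuous g} ->
  (\int[mu]_(x in Iedge m) \int[mu]_(y in Iedge m) (kern g x y)%:E <= j%:E)%E ->
  0 <= a -> b <= edgelen R m -> b = a + edgelen R N ->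
  a <= a' -> b' <= b -> b' = a' + edgelen R N.+1 ->
  (avg g a' b' - avg g a b) ^+ 2 <= 2 * (3 / 5) ^+ N * j.
Proof.
move=> cg hj a0 bL bE aa' b'b b'E.
have hN := edgelen_gt0 R N; have hN1 := edgelen_gt0 R N.+1.
have ab : a < b by rewrite bE; lra.
have ab' : a' < b' by rewrite b'E; lra.
have sub : `[a, b] `<=` @Iedge R m.
  by move=> x /=; rewrite in_itv /= => /andP[h1 h2]; apply/andP; split; lra.
have sub' : `[a', b'] `<=` `[a, b].
  by move=> x /=; rewrite !in_itv /= => /andP[h1 h2]; apply/andP; split; lra.
have cI := continuous_subspaceW sub cg.
have cI' := continuous_subspaceW sub' cI.
have k0 x y : (0 <= (kern g x y)%:E)%E by rewrite lee_fin kern_ge0.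
pose c := (20 / 3) ^+ N * (b - a).
have p0 : 0 <= (20 / 3) ^+ N :> R by apply: exprn_ge0; lra.
have c0 : 0 <= c by apply: mulr_ge0 => //; lra.
have inner x : `[a', b']%classic x ->
    ((c * (g x - avg g a b) ^+ 2)%:E <= \int[mu]_(y in Iedge m) (kern g x y)%:E)%E.
  move=> xI'; have := sub' _ xI'; rewrite /= in_itv /= => /andP[x1 x2].
  have : ((c * (g x - avg g a b) ^+ 2)%:E <=
      \int[mu]_(y in `[a, b]) ((20 / 3) ^+ N * (g y - g x) ^+ 2)%:E)%E.
    apply: le_trans (integral_sqr_ge _ ab p0 cI).
    by rewrite lee_fin /c -mulrA -[in leLHS]sqrrN opprB.
  move=> h; apply: (le_trans h); apply: ge0_le_integral_nonmeas => // y.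
    by move=> _; rewrite lee_fin mulr_ge0 ?sqr_ge0.
  rewrite /= in_itv /= => /andP[y1 y2]; rewrite lee_fin kernC.
  by apply: kern_ge; rewrite ler_norml; apply/andP; split; lra.
have : ((c * ((b' - a') * (avg g a' b' - avg g a b) ^+ 2))%:E <= j%:E)%E.
  apply: le_trans hj; apply: le_trans (integral_sqr_ge _ ab' c0 cI') _.
  apply: ge0_le_integral_nonmeas => //.
  - exact: subset_trans sub' sub.
  - by move=> x _; rewrite lee_fin mulr_ge0 ?sqr_ge0.
  - by move=> x _; apply: integral_ge0.
rewrite lee_fin; set S := _ ^+ 2 => hS.
have E : c * (b' - a') = (5 / 3) ^+ N / 2.
  have e : (20 / 3) ^+ N = (5 / 3) ^+ N * (2 ^+ N) ^+ 2 :> R.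
    by rewrite -exprM mulnC exprM -exprMn; congr (_ ^+ _); field.
  rewrite /c bE b'E edgelenS e /edgelen; field.
  by rewrite expf_neq0 // pnatr_eq0.
have q0 : 0 < (3 / 5) ^+ N :> R by apply: exprn_gt0; lra.
have qE : (3 / 5) ^+ N * (5 / 3) ^+ N = 1 :> R.
  by rewrite -exprMn (_ : _ * _ = 1) ?expr1n //; field.
rewrite mulrA E in hS.
have -> : S = 2 * ((3 / 5) ^+ N * ((5 / 3) ^+ N / 2 * S)).
  by rewrite mulrA mulrA mulrA -[2 * _ * _]mulrA qE; field.
rewrite -[leRHS]mulrA; apply: ler_wpM2l; first by [].
by apply: ler_wpM2l; first exact: ltW.
Qed.

Lemma avg_cvg g m (a b : nat -> R) (z : R) :
  {within Iedge m, continuous g} ->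
  (forall k, 0 <= a k) -> (forall k, b k <= edgelen R m) ->
  (forall k, a k < b k) -> (forall k, a k <= z <= b k) ->
  a @ \oo --> z -> b @ \oo --> z -> avg g (a k) (b k) @[k --> \oo] --> g z.
Proof.
move=> cg a0 bL ab azb az bz.
have sub k : `[a k, b k] `<=` @Iedge R m.
  move=> x /=; rewrite in_itv /= => /andP[h1 h2].
  by apply/andP; split; [apply: le_trans h1|apply: le_trans h2 _].
have ex k : exists p : R * R, [/\ a k <= p.1 <= b k, a k <= p.2 <= b k &
    g p.1 <= avg g (a k) (b k) <= g p.2].
  have [x [y [h1 h2 h3]]] := avg_between (ab k) (continuous_subspaceW (@sub k) cg).
  by exists (x, y).
have [p hp] := choice ex.
have zI : Iedge m z by apply: (sub 0%N); rewrite /= in_itv /= azb.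
have cvg_pt (u : nat -> R) : (forall k, a k <= u k <= b k) -> g (u k) @[k --> \oo] --> g z.
  move=> hu; apply: within_continuous_cvg cg zI _ _.
    by move=> k; apply: (sub k); rewrite /= in_itv /= hu.
  by apply: squeeze_cvgr az bz; exact: nearW.
apply: (@squeeze_cvgr _ _ _ _ (fun k => g (p k).1) (fun k => g (p k).2)).
- by apply: nearW => k; have [] := hp k.
- by apply: cvg_pt => k; have [] := hp k.
- by apply: cvg_pt => k; have [] := hp k.
Qed.

(** The averages over halving nested intervals converge to the value at their common point [z]. By
    [avg_step] and the weighted Cauchy-Schwarz inequality the telescoping sum costs
    [4 * 2 * 5 = 40]. *)
Lemma avg_endpoint g m (a : nat -> R) (z j : R) :
  {within Iedge m, continuous g} ->
  (\int[mu]_(x in Iedge m) \int[mu]_(y in Iedge m) (kern g x y)%:E <= j%:E)%E ->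
  (forall k, 0 <= a k) -> (forall k, a k + edgelen R (m + k) <= edgelen R m) ->
  (forall k, a k <= a k.+1) ->
  (forall k, a k.+1 + edgelen R (m + k.+1) <= a k + edgelen R (m + k)) ->
  (forall k, a k <= z <= a k + edgelen R (m + k)) ->
  (g z - avg g (a 0%N) (a 0%N + edgelen R m)) ^+ 2 <= 40 * (3 / 5) ^+ m * j.
Proof.
move=> cg hj a0 bL anD bnI azb.
have j0 : 0 <= j.
  rewrite -lee_fin; apply: le_trans hj; apply: integral_ge0 => x _.
  by apply: integral_ge0 => y _; rewrite lee_fin kern_ge0.
pose A k := avg g (a k) (a k + edgelen R (m + k)).
have len0 : edgelen R (m + k) @[k --> \oo] --> (0 : R).
  have -> : (fun k => edgelen R (m + k)) = [sequence edgelen R (k + m)]_k.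
    by apply/funext => k; rewrite addnC.
  by rewrite cvg_shiftn; exact: cvg_edgelen.
have az : a @ \oo --> z.
  apply: (@squeeze_cvgr _ _ _ _ (fun k => z - edgelen R (m + k)) (fun=> z)).
  - by apply: nearW => k; have := azb k; lra.
  - by rewrite -[X in _ --> X]subr0; apply: cvgB => //; exact: cvg_cst.
  - exact: cvg_cst.
have bz : a k + edgelen R (m + k) @[k --> \oo] --> z.
  by rewrite -[X in _ --> X]addr0; apply: cvgD.
have Acvg : A @ \oo --> g z.
  apply: avg_cvg cg a0 bL _ azb az bz => k; rewrite ltrDl; exact: edgelen_gt0.
have -> : avg g (a 0%N) (a 0%N + edgelen R m) = A 0%N by rewrite /A addn0.
apply: cvg_sqr_le Acvg _ => K.
pose d k := A k.+1 - A k.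
have dE : A K - A 0%N = \sum_(k < K) d k.
  elim: K => [|K IH]; first by rewrite big_ord0 subrr.
  by rewrite big_ord_recr /= -IH /d; ring.
rewrite dE; apply: le_trans (weighted_cauchy_schwarz _ _) _.
have dk k : (4 / 3) ^+ k * d k ^+ 2 <= 2 * (3 / 5) ^+ m * j * (4 / 5) ^+ k.
  have h : d k ^+ 2 <= 2 * (3 / 5) ^+ (m + k) * j.
    by apply: avg_step cg hj (a0 k) (bL k) _ (anD k) (bnI k) _; rewrite ?addnS.
  have e : (4 / 5) ^+ k = (4 / 3) ^+ k * (3 / 5) ^+ k :> R.
    by rewrite -exprMn; congr (_ ^+ _); field.
  have -> : 2 * (3 / 5) ^+ m * j * (4 / 5) ^+ k =
     (4 / 3) ^+ k * (2 * (3 / 5) ^+ (m + k) * j) by rewrite e exprD; ring.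
  by apply: ler_wpM2l => //; apply: exprn_ge0; lra.
have C0 : 0 <= 2 * (3 / 5) ^+ m * j.
  by rewrite mulr_ge0 // mulr_ge0 // exprn_ge0 //; lra.
have -> : 40 * (3 / 5) ^+ m * j = 4 * (2 * (3 / 5) ^+ m * j * 5) by ring.
apply: ler_wpM2l; first lra.
apply: (@le_trans _ _ (\sum_(k < K) 2 * (3 / 5) ^+ m * j * (4 / 5) ^+ k)).
  by apply: ler_sum => k _; exact: dk.
by rewrite -mulr_sumr; apply: ler_wpM2l => //; exact: geometric_sum_le.
Qed.

(** The halving intervals are anchored once at the left end and once at the right end. Both chains
    start from the average over the whole edge, so the two errors combine to
    [2 * (40 + 40) = 160]. *)
Lemma endpoints_le_integral_kern g m (j : R) :
  {within Iedge m, continuous g} ->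
  (\int[mu]_(x in Iedge m) \int[mu]_(y in Iedge m) (kern g x y)%:E <= j%:E)%E ->
  (g (edgelen R m) - g 0) ^+ 2 <= 160 * (3 / 5) ^+ m * j.
Proof.
move=> cg hj.
have lenS k : edgelen R (m + k.+1) = edgelen R (m + k) / 2.
  by rewrite addnS edgelenS.
have len_le k : edgelen R (m + k) <= edgelen R m.
  elim: k => [|k IH]; first by rewrite addn0.
  by rewrite lenS; have := edgelen_ge0 R (m + k); lra.
have lenP k := edgelen_ge0 R (m + k).
have h0 := @avg_endpoint g m (fun=> 0) 0 j cg hj.
have h1 := @avg_endpoint g m (fun k => edgelen R m - edgelen R (m + k))
  (edgelen R m) j cg hj.
have {}h0 : (g 0 - avg g 0 (edgelen R m)) ^+ 2 <= 40 * (3 / 5) ^+ m * j.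
  rewrite /= (add0r (edgelen R m)) in h0; apply: h0 => // k; rewrite ?add0r ?lexx ?lenP //.
  by rewrite lenS; have := lenP k; lra.
have {}h1 : (g (edgelen R m) - avg g 0 (edgelen R m)) ^+ 2 <= 40 * (3 / 5) ^+ m * j.
  have e : edgelen R m - edgelen R (m + 0) = 0 by rewrite addn0 subrr.
  rewrite /= e (add0r (edgelen R m)) in h1; apply: h1 => k; have := lenP k; have := len_le k;
    rewrite ?lenS; lra.
have := sqr_ge0 (g (edgelen R m) + g 0 - 2 * avg g 0 (edgelen R m)).
have -> : 160 * (3 / 5) ^+ m * j = 4 * (40 * (3 / 5) ^+ m * j) by ring.
move: h0 h1; set C := _ * j; nra.
Qed.

End GagliardoLower.

(** * Cells and discrete energies *)

(** Written in the form that [big_ord_recl] produces, so that expanded sums over ['I_3] match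
    syntactically. *)
Notation o0 := (ord0 : 'I_3).
Notation o1 := (lift ord0 ord0 : 'I_3).
Notation o2 := (lift ord0 (lift ord0 ord0) : 'I_3).

Lemma sum_ord3 (V : nmodType) (f : 'I_3 -> V) : \sum_i f i = f o0 + (f o1 + f o2).
Proof. by rewrite !big_ord_recl big_ord0 addr0. Qed.

Lemma ord3_cases (k : 'I_3) : [\/ k = o0, k = o1 | k = o2].
Proof.
by case: k => [[|[|[|k]]] hk] //; [apply: Or31|apply: Or32|apply: Or33]; exact/val_inj.
Qed.

Section TripleEnergy.
Variable R : realType.
Implicit Types a b c x y z : R.

Definition triple_energy a b c : R := (a - b) ^+ 2 + (b - c) ^+ 2 + (a - c) ^+ 2.

Lemma triple_energy_ge0 a b c : 0 <= triple_energy a b c.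
Proof. by rewrite !addr_ge0 ?sqr_ge0. Qed.

(* Equality holds exactly when [x], [y], [z] are the values [(2a+2b+c)/5], ...
   of the harmonic extension. *)
Lemma triple_energy_refine a b c x y z :
  triple_energy a b c <=
  5 / 3 * (triple_energy a x z + triple_energy x b y + triple_energy z y c).
Proof.
have := sqr_ge0 (x - (2 * a + 2 * b + c) / 5).
have := sqr_ge0 (y - (2 * b + 2 * c + a) / 5).
have := sqr_ge0 (z - (2 * a + 2 * c + b) / 5).
have := sqr_ge0 ((x - (2 * a + 2 * b + c) / 5) - (y - (2 * b + 2 * c + a) / 5)).
have := sqr_ge0 ((x - (2 * a + 2 * b + c) / 5) - (z - (2 * a + 2 * c + b) / 5)).
have := sqr_ge0 ((y - (2 * b + 2 * c + a) / 5) - (z - (2 * a + 2 * c + b) / 5)).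
rewrite /triple_energy; lra.
Qed.

(* For the harmonic extension the two cells along an edge carry at most 14/15
   of the energy; the last term pays for the deviation from harmonicity. *)
Lemma triple_energy_edge a b c x y z :
  5 / 3 * (triple_energy a x z + triple_energy x b y) <=
  29 / 30 * triple_energy a b c +
  2 * (5 / 3 * (triple_energy a x z + triple_energy x b y + triple_energy z y c) -
       triple_energy a b c).
Proof.
(* Completion of squares with [c] translated to 0, eliminating [x], then [y], then [z]; the
   remaining form in [a] and [b] is diagonal in [a - b] and [a + b]. *)
have := sqr_ge0 (4 * (x - c) - (y - c) - (z - c) - (b - c) - (a - c)).
have := sqr_ge0 (23 * (y - c) - 9 * (z - c) - 5 * (b - c) - (a - c)).
have := sqr_ge0 (112 * (z - c) - 17 * (b - c) - 31 * (a - c)).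
have := sqr_ge0 (a - b).
have := sqr_ge0 ((a - c) + (b - c)).
rewrite /triple_energy; lra.
Qed.

End TripleEnergy.

Section Words.
Variable R : realType.
Implicit Types (w v : seq 'I_3) (p : pt R).

Definition Phis w : pt R -> pt R := foldr (fun i g => @Phi R i \o g) id w.

Lemma Phis_cat w v p : Phis (w ++ v) p = Phis w (Phis v p).
Proof. by elim: w => //= i w IH; rewrite IH. Qed.

Lemma Phis_rcons w i p : Phis (rcons w i) p = Phis w (Phi i p).
Proof. by rewrite -cats1 Phis_cat. Qed.

Lemma Phi_sym i j : Phi i (q R j) = Phi j (q R i).
Proof. by rewrite /Phi; congr pair; rewrite addrC. Qed.

Lemma Phi_fix i : Phi i (q R i) = q R i.
Proof. by rewrite /Phi [RHS]surjective_pairing; congr pair; field. Qed.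

Definition seg i j (t : R) : pt R :=
  ((q R i).1 + t * ((q R j).1 - (q R i).1), (q R i).2 + t * ((q R j).2 - (q R i).2)).

Lemma seg0 i j : seg i j 0 = q R i.
Proof. by rewrite /seg [RHS]surjective_pairing !mul0r !addr0. Qed.

Lemma seg1 i j : seg i j 1 = q R j.
Proof. by rewrite /seg [RHS]surjective_pairing !mul1r; congr pair; ring. Qed.

Lemma Phi_seg_l i j t : Phi i (seg i j t) = seg i j (t / 2).
Proof. by rewrite /Phi /seg /=; congr pair; field. Qed.

Lemma Phi_seg_r i j t : Phi j (seg i j t) = seg i j ((t + 1) / 2).
Proof. by rewrite /Phi /seg /=; congr pair; field. Qed.

Lemma edgeE m (w : m.-tuple 'I_3) i j x : edge w i j x = Phis w (seg i j (2 ^+ m * x)).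
Proof. by []. Qed.

(* The [2 ^ n] level-[n] subcells of the cell [w] along its edge [i j], listed
   from [i] to [j]: the binary digits of [l] select the letters. *)
Fixpoint edge_word i j n (l : nat) w : seq 'I_3 :=
  if n is n'.+1 then rcons (edge_word i j n' l./2 w) (if odd l then j else i) else w.

Lemma size_edge_word i j n l w : size (edge_word i j n l w) = (size w + n)%N.
Proof. by elim: n l => [|n IH] l /=; rewrite ?addn0 // size_rcons IH addnS. Qed.

Lemma Phis_edge_word i j n l w t : (l < 2 ^ n)%N ->
  Phis (edge_word i j n l w) (seg i j t) = Phis w (seg i j ((t + l%:R) / 2 ^+ n)).
Proof.
move=> ln; elim: n l ln t => [|n IH] l ln t /=.
  by move: ln; rewrite expn0 ltnS leqn0 => /eqP ->; rewrite addr0 expr0 divr1.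
have l2 : (l./2 < 2 ^ n)%N by rewrite expnS in ln; lia.
have lE : l%:R = (odd l)%:R + 2 * (l./2)%:R :> R.
  by rewrite -{1}[l]odd_double_half -muln2 natrD natrM mulrC.
have p2 : (2 : R) ^+ n != 0 by rewrite expf_neq0 // pnatr_eq0.
rewrite Phis_rcons lE exprS; case: (odd l); rewrite ?Phi_seg_r ?Phi_seg_l IH //;
  by congr (Phis w (seg i j _)); rewrite ?mulr1n ?mulr0n; field.
Qed.

Lemma edge_dyad_l m (w : m.-tuple 'I_3) i j n l : (l < 2 ^ n)%N ->
  edge w i j (dyad R (m + n) l) = Phis (edge_word i j n l w) (q R i).
Proof.
move=> ln; rewrite edgeE -(seg0 i j) Phis_edge_word //.
congr (Phis w (seg i j _)); rewrite /dyad /edgelen exprD; field.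
by rewrite !expf_neq0 // pnatr_eq0.
Qed.

Lemma edge_dyad_r m (w : m.-tuple 'I_3) i j n l : (l < 2 ^ n)%N ->
  edge w i j (dyad R (m + n) l.+1) = Phis (edge_word i j n l w) (q R j).
Proof.
move=> ln; rewrite edgeE -(seg1 i j) Phis_edge_word //.
congr (Phis w (seg i j _)); rewrite /dyad /edgelen exprD -natr1; field.
by rewrite !expf_neq0 // pnatr_eq0.
Qed.

Definition cell_energy (F : pt R -> R) w : R :=
  triple_energy (F (Phis w (q R o0))) (F (Phis w (q R o1))) (F (Phis w (q R o2))).

Lemma cell_energy_ge0 F w : 0 <= cell_energy F w.
Proof. exact: triple_energy_ge0. Qed.

Definition child_energy F w : R := \sum_i cell_energy F (rcons w i).

(** Zero exactly when [F] takes the harmonic values at the three midpoints of the cell; its sums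
    over a level are the increments of [Eseq], up to scaling. *)
Definition energy_defect F w : R := 5 / 3 * child_energy F w - cell_energy F w.

Lemma child_energyE F w : child_energy F w =
  triple_energy (F (Phis w (q R o0))) (F (Phis w (Phi o0 (q R o1))))
    (F (Phis w (Phi o0 (q R o2)))) +
  triple_energy (F (Phis w (Phi o0 (q R o1)))) (F (Phis w (q R o1)))
    (F (Phis w (Phi o1 (q R o2)))) +
  triple_energy (F (Phis w (Phi o0 (q R o2)))) (F (Phis w (Phi o1 (q R o2))))
    (F (Phis w (q R o2))).
Proof.
rewrite /child_energy sum_ord3 /cell_energy !Phis_rcons !Phi_fix.
by rewrite (Phi_sym o1 o0) (Phi_sym o2 o0) (Phi_sym o2 o1) addrA.
Qed.

Lemma energy_defect_ge0 F w : 0 <= energy_defect F w.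
Proof. by rewrite subr_ge0 child_energyE; exact: triple_energy_refine. Qed.

Lemma edge_cells_energy_le F w (i j : 'I_3) : (i < j)%N ->
  5 / 3 * (cell_energy F (rcons w i) + cell_energy F (rcons w j)) <=
  29 / 30 * cell_energy F w + 2 * energy_defect F w.
Proof.
have tC (a b c : R) : triple_energy a b c = triple_energy b a c.
  by rewrite /triple_energy; ring.
have tC' (a b c : R) : triple_energy a b c = triple_energy a c b.
  by rewrite /triple_energy; ring.
rewrite /energy_defect child_energyE /cell_energy !Phis_rcons.
pose a := F (Phis w (q R o0)); pose b := F (Phis w (q R o1)).
pose c := F (Phis w (q R o2)); pose x := F (Phis w (Phi o0 (q R o1))).
pose y := F (Phis w (Phi o1 (q R o2))); pose z := F (Phis w (Phi o0 (q R o2))).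
(* One instance for each of the three edges, permuting the vertices together with the midpoints. *)
have := triple_energy_edge a b c x y z; have := triple_energy_edge a c b z y x.
have := triple_energy_edge b c a y z x.
case: (ord3_cases i) => ->; case: (ord3_cases j) => -> //= h1 h2 h3 _;
  rewrite ?Phi_fix ?(Phi_sym o1 o0) ?(Phi_sym o2 o0) ?(Phi_sym o2 o1) -/a -/b -/c -/x -/y -/z.
- exact: h3.
- move: h2; rewrite /triple_energy; lra.
- move: h1; rewrite /triple_energy; lra.
Qed.

Lemma vertex_sqr_le F w i j :
  (F (Phis w (q R j)) - F (Phis w (q R i))) ^+ 2 <= cell_energy F w.
Proof.
rewrite /cell_energy /triple_energy.
set a := F (Phis w (q R o0)); set b := F (Phis w (q R o1)); set c := F (Phis w (q R o2)).
have := sqr_ge0 (a - b); have := sqr_ge0 (b - c); have := sqr_ge0 (a - c).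
by case: (ord3_cases i) => ->; case: (ord3_cases j) => ->; rewrite -/a -/b -/c; lra.
Qed.

End Words.

Section WordSums.
Variable R : realType.
Implicit Types (G : seq 'I_3 -> R) (F : pt R -> R) (w : seq 'I_3).

Definition word_sum m G : R := \sum_(w : m.-tuple 'I_3) G w.

Lemma word_sum_cons m G : word_sum m.+1 G = \sum_i word_sum m (fun w => G (i :: w)).
Proof.
rewrite /word_sum pair_big /=.
rewrite (reindex (fun p : 'I_3 * m.-tuple 'I_3 => cons_tuple p.1 p.2)) //=.
exists (fun t : m.+1.-tuple 'I_3 => (thead t, behead_tuple t)) => [[i w] _|t _] /=.
  by congr pair; exact/val_inj.
by rewrite [RHS]tuple_eta; exact/val_inj.
Qed.

Lemma word_sum_rcons m G :
  word_sum m.+1 G = word_sum m (fun w => \sum_i G (rcons w i)).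
Proof.
elim: m G => [|m IH] G.
  rewrite word_sum_cons /word_sum exchange_big /=; apply: eq_bigr => w _.
  by apply: eq_bigr => i _; rewrite tuple0.
rewrite word_sum_cons; under eq_bigr do rewrite IH.
by rewrite [RHS]word_sum_cons.
Qed.

Lemma ler_word_sum m G G' : (forall w, G w <= G' w) -> word_sum m G <= word_sum m G'.
Proof. by move=> h; apply: ler_sum => w _; exact: h. Qed.

Lemma word_sum_ge0 m G : (forall w, 0 <= G w) -> 0 <= word_sum m G.
Proof. by move=> h; apply: sumr_ge0 => w _; exact: h. Qed.

Lemma word_sumZ m (k : R) G : word_sum m (fun w => k * G w) = k * word_sum m G.
Proof. by rewrite /word_sum mulr_sumr. Qed.

Lemma word_sumD m G G' :
  word_sum m (fun w => G w + G' w) = word_sum m G + word_sum m G'.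
Proof. by rewrite /word_sum big_split. Qed.

Definition edge_sum i j k G w : R := \sum_(l < 2 ^ k) G (edge_word i j k l w).

(** The letters are appended at the end, so the cells [2 l] and [2 l + 1] of depth [k.+1] are
    children of the cell [l] of depth [k]. *)
Lemma edge_sumS i j k G w :
  edge_sum i j k.+1 G w = edge_sum i j k (fun v => G (rcons v i) + G (rcons v j)) w.
Proof.
rewrite /edge_sum expnS mul2n (sumr_double (fun l => G (edge_word i j k.+1 l w))).
apply: eq_bigr => l _; congr (G _ + G _).
  by change (rcons (edge_word i j k (l.*2)./2 w) (if odd l.*2 then j else i) =
    rcons (edge_word i j k l w) i); rewrite doubleK odd_double.
change (rcons (edge_word i j k (l.*2.+1)./2 w) (if odd l.*2.+1 then j else i) =
  rcons (edge_word i j k l w) j).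
by rewrite -uphalfE uphalf_double oddS odd_double.
Qed.

(** Each refinement keeps two distinct children out of three along the edge; adding the third can
    only increase the sum. *)
Lemma edge_sum_le_word_sum m i j k G : i != j -> (forall w, 0 <= G w) ->
  word_sum m (edge_sum i j k G) <= word_sum (m + k) G.
Proof.
move=> ij; elim: k G => [|k IH] G G0.
  rewrite addn0; apply: ler_word_sum => w.
  by rewrite /edge_sum big_ord_recl big_ord0 addr0.
have -> : word_sum m (edge_sum i j k.+1 G) =
    word_sum m (edge_sum i j k (fun v => G (rcons v i) + G (rcons v j))).
  by apply: eq_bigr => w _; exact: edge_sumS.
apply: le_trans (IH _ _) _; first by move=> w; rewrite addr_ge0.
rewrite addnS word_sum_rcons; apply: ler_word_sum => w.
rewrite (bigD1 i) //= (bigD1 j) 1?eq_sym //= addrA lerDl.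
by apply: sumr_ge0.
Qed.

(** The sum in [Em] runs over ordered pairs, hence the factor 2. *)
Lemma EmE F m : Em F m = 2 * word_sum m (cell_energy F).
Proof.
rewrite /Em; under eq_bigr do rewrite big_mkcond /=.
rewrite sum_ord3 !sum_ord3 /= !(add0r, addr0).
rewrite /word_sum /cell_energy /triple_energy !big_split /=.
pose d i j := \sum_(w : m.-tuple 'I_3) (F (Phis w (q R i)) - F (Phis w (q R j))) ^+ 2.
have dC i j : d i j = d j i by apply: eq_bigr => w _; rewrite -sqrrN opprB.
rewrite -/(d o0 o1) -/(d o0 o2) -/(d o1 o2) -/(d o1 o0) -/(d o2 o0) -/(d o2 o1).
by rewrite (dC o1 o0) (dC o2 o0) (dC o2 o1); ring.
Qed.

End WordSums.

(** * Restriction to the graphs *)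

Lemma within_continuous_comp (T U V : topologicalType) (A : set T) (B : set U)
    (h : T -> U) (F : U -> V) :
  continuous h -> (forall x, A x -> B (h x)) ->
  {within B, continuous F} -> {within A, continuous (F \o h)}.
Proof.
move=> ch hAB /subspace_continuousP cF; apply/subspace_continuousP => x Ax.
apply: (@cvg_comp _ _ _ h F _ (within B (nbhs (h x)))); last exact: cF (hAB _ Ax).
move=> P wP; have hP : nbhs x (h @^-1` [set y | B y -> P y]) := ch x _ wP.
by apply: (@filterS _ (nbhs x) _ _ _ _ hP) => y yP Ay; exact: yP (hAB _ Ay).
Qed.

Lemma sum_lt_ord3 (R : numDomainType) (G : 'I_3 -> 'I_3 -> \bar R) :
  (\sum_(i < 3) \sum_(j < 3 | (i < j)%N) G i j = G o0 o1 + G o0 o2 + G o1 o2)%E.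
Proof.
under eq_bigr do rewrite big_mkcond /=.
by rewrite !big_ord_recl !big_ord0 /= !(add0e, adde0).
Qed.

Section EnergyUpper.
Variable R : realType.
Variable F : pt R -> R.
Local Notation mu := (@lebesgue_measure R).

Lemma continuous_Phi i : continuous (@Phi R i).
Proof.
move=> x.
have c1 : 2^-1 * y.1 + 2^-1 * (q R i).1 @[y --> x] --> 2^-1 * x.1 + 2^-1 * (q R i).1.
  by apply: cvgD; [apply: cvgMl_tmp; exact: cvg_fst|exact: cvg_cst].
have c2 : 2^-1 * y.2 + 2^-1 * (q R i).2 @[y --> x] --> 2^-1 * x.2 + 2^-1 * (q R i).2.
  by apply: cvgD; [apply: cvgMl_tmp; exact: cvg_snd|exact: cvg_cst].
exact: (cvg_pair c1 c2).
Qed.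

Lemma continuous_Phis w : continuous (@Phis R w).
Proof.
elim: w => [|i w IH]; first by move=> x; exact: cvg_id.
move=> x; apply: (@continuous_comp (pt R) (pt R) (pt R) (Phis w) (Phi i)).
  exact: IH.
exact: continuous_Phi.
Qed.

Lemma continuous_edge m (w : m.-tuple 'I_3) i j : continuous (@edge R m w i j).
Proof.
move=> x; pose h (y : R) : pt R := seg i j (2 ^+ m * y).
suff hx : {for x, continuous h}.
  exact: (@continuous_comp R (pt R) (pt R) h (Phis w) x hx (@continuous_Phis w _)).
have c a b : a + 2 ^+ m * y * b @[y --> x] --> a + 2 ^+ m * x * b.
  apply: cvgD; first exact: cvg_cst.
  by apply: cvgMr_tmp; apply: cvgMl_tmp; exact: cvg_id.
exact: (cvg_pair (c _ _) (c _ _)).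
Qed.

Lemma within_edge_continuous m (w : m.-tuple 'I_3) (i j : 'I_3) : i != j ->
  {within @SGm R m, continuous F} ->
  {within Iedge m, continuous (fun x => F (edge w i j x))}.
Proof.
move=> ij cF; apply: (within_continuous_comp (@continuous_edge m w i j)) cF => x Ix.
by exists w, i, j; split => //; exists x.
Qed.

Lemma EseqE n : Eseq F n = 2 * ((5 / 3) ^+ n * word_sum n (cell_energy F)).
Proof. by rewrite /Eseq EmE; ring. Qed.

Lemma energy_defectE n : 2 * ((5 / 3) ^+ n * word_sum n (energy_defect F)) =
  Eseq F n.+1 - Eseq F n.
Proof.
have -> : word_sum n (energy_defect F) =
    5 / 3 * word_sum n.+1 (cell_energy F) - word_sum n (cell_energy F).
  rewrite word_sum_rcons /word_sum mulr_sumr -sumrB; exact: eq_bigr.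
by rewrite !EseqE exprS; ring.
Qed.

Lemma Eseq_nd : nondecreasing_seq (Eseq F).
Proof.
apply/nondecreasing_seqP => n; rewrite -subr_ge0 -energy_defectE.
apply: mulr_ge0 => //; apply: mulr_ge0; first by apply: exprn_ge0; lra.
by apply: word_sum_ge0 => w; exact: energy_defect_ge0.
Qed.

Definition edge_energy i j m k : R :=
  (5 / 3) ^+ (m + k) * word_sum m (edge_sum i j k (cell_energy F)).

(** The defects along the edges are at most all the defects of the level, and the factor 2 in front
    of them is exactly the one relating cell sums to [Eseq]. *)
Lemma edge_energy_step (i j : 'I_3) m k : (i < j)%N ->
  edge_energy i j m k.+1 <=
  29 / 30 * edge_energy i j m k + (Eseq F (m + k).+1 - Eseq F (m + k)).
Proof.
move=> ij; have p0 : 0 <= (5 / 3) ^+ (m + k) :> R by apply: exprn_ge0; lra.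
have ne : i != j by rewrite neq_ltn ij.
have h : 5 / 3 * word_sum m (edge_sum i j k.+1 (cell_energy F)) <=
    29 / 30 * word_sum m (edge_sum i j k (cell_energy F)) +
    2 * word_sum m (edge_sum i j k (energy_defect F)).
  rewrite -!word_sumZ -word_sumD; apply: ler_word_sum => w.
  rewrite edge_sumS /edge_sum !mulr_sumr -big_split /=; apply: ler_sum => l _.
  exact: edge_cells_energy_le.
have := edge_sum_le_word_sum m k ne (energy_defect_ge0 F).
rewrite -energy_defectE /edge_energy addnS exprS.
move: h; set x := word_sum m _; set y := word_sum m _; set z := word_sum m _.
set t := word_sum _ _ => h1 h2.
have := ler_wpM2l p0 h1; have := ler_wpM2l p0 h2; lra.
Qed.

(** Subtracting 29 times the last term lets the induction close: 30 times the contraction reads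
    [30 X' <= 29 X + 30 * gain], and the gains telescope in [Eseq]. *)
Lemma sum_edge_energy_le (i j : 'I_3) m K : (i < j)%N ->
  \sum_(k < K.+1) edge_energy i j m k <=
  30 * Eseq F (m + K) - 29 * edge_energy i j m K.
Proof.
move=> ij; elim: K => [|K IH].
  rewrite big_ord_recl big_ord0 addr0 addn0 EseqE /edge_energy addn0.
  have -> : word_sum m (edge_sum i j 0 (cell_energy F)) = word_sum m (cell_energy F).
    by apply: eq_bigr => w _; rewrite /edge_sum big_ord_recl big_ord0 addr0.
  have : 0 <= (5 / 3) ^+ m * word_sum m (cell_energy F).
    apply: mulr_ge0; first by apply: exprn_ge0; lra.
    by apply: word_sum_ge0 => w; exact: cell_energy_ge0.
  lra.
rewrite big_ord_recr /=; have := edge_energy_step m K ij; rewrite addnS; lra.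
Qed.

Lemma sum_edge_energy_le_energy (i j : 'I_3) m K : (i < j)%N ->
  cvg (Eseq F @ \oo) -> \sum_(k < K) edge_energy i j m k <= 30 * energy F.
Proof.
move=> ij cE; have Ele n : Eseq F n <= energy F.
  exact: nondecreasing_cvgn_le Eseq_nd cE n.
have X0 k : 0 <= edge_energy i j m k.
  apply: mulr_ge0; first by apply: exprn_ge0; lra.
  by apply: word_sum_ge0 => w; apply: sumr_ge0 => l _; exact: cell_energy_ge0.
apply: (@le_trans _ _ (\sum_(k < K.+1) edge_energy i j m k)).
  by rewrite big_ord_recr /= lerDl.
by apply: le_trans (sum_edge_energy_le m K ij) _; have := X0 K; have := Ele (m + K)%N; lra.
Qed.

Lemma variation_edge_le m (w : m.-tuple 'I_3) i j k :
  variation (fun x => F (edge w i j x)) m k <= edge_sum i j k (cell_energy F) w.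
Proof.
apply: ler_sum => l _; rewrite /sqincr edge_dyad_r // edge_dyad_l //.
exact: vertex_sqr_le.
Qed.

Lemma sum_integral_kern_le_energy (i j : 'I_3) m : (i < j)%N ->
  {within @SGm R m, continuous F} -> cvg (Eseq F @ \oo) ->
  (\sum_(w : m.-tuple 'I_3)
    \int[mu]_(x in Iedge m) \int[mu]_(y in Iedge m)
      (kern (fun x => F (edge w i j x)) x y)%:E <=
   (6400 * (30 * energy F))%:E)%E.
Proof.
move=> ij cF cE; have ne : i != j by rewrite neq_ltn ij.
pose v (w : m.-tuple 'I_3) k := (5 / 3) ^+ k * variation (fun x => F (edge w i j x)) m k.
have v0 w k : (0 <= (v w k)%:E)%E.
  rewrite lee_fin; apply: mulr_ge0; first by apply: exprn_ge0; lra.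
  exact: variation_ge0.
have c0 : 0 <= 6400 * (5 / 3) ^+ m :> R.
  by apply: mulr_ge0; [lra|apply: exprn_ge0; lra].
apply: (@le_trans _ _ (\sum_(w : m.-tuple 'I_3)
    (6400 * (5 / 3) ^+ m)%:E * \sum_(k <oo) (v w k)%:E)%E).
  apply: lee_sum => w _; apply: integral_kern_le_series.
  exact: within_edge_continuous.
rewrite -ge0_sume_distrr; last by move=> w _; exact: nneseries_ge0.
rewrite -nneseries_sum; last by move=> w k _; exact: v0.
(* [edge_energy] carries the factor [(5/3)^(m+k)], while [v] has only [(5/3)^k]; the inserted
   [(3/5)^m] makes up the difference and cancels the [(5/3)^m] of the integral bound. *)
have -> : 6400 * (30 * energy F) =
    6400 * (5 / 3) ^+ m * ((3 / 5) ^+ m * (30 * energy F)).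
  have qE : (5 / 3) ^+ m * (3 / 5) ^+ m = 1 :> R.
    by rewrite -exprMn (_ : _ * _ = 1) ?expr1n //; field.
  by rewrite -[in RHS]mulrA (mulrA ((5 / 3) ^+ m)) qE mul1r.
rewrite [leRHS]EFinM; apply: lee_wpmul2l; first by rewrite lee_fin.
apply: lime_le.
  by apply: is_cvg_nneseries => k _ _; apply: sume_ge0 => w _; exact: v0.
apply: nearW => K; rewrite big_mkord.
apply: (@le_trans _ _ (\sum_(k < K) ((3 / 5) ^+ m * edge_energy i j m k)%:E)%E).
  apply: lee_sum => k _; rewrite sumEFin lee_fin /edge_energy.
  have qE : (3 / 5) ^+ m * (5 / 3) ^+ (m + k) = (5 / 3) ^+ k :> R.
    have e : 3 / 5 * (5 / 3) = 1 :> R by field.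
    by rewrite exprD mulrA -exprMn e expr1n mul1r.
  rewrite mulrA qE -word_sumZ; apply: ler_sum => w _; rewrite /v.
  apply: ler_wpM2l; first by apply: exprn_ge0; lra.
  exact: variation_edge_le.
rewrite sumEFin lee_fin -mulr_sumr; apply: ler_wpM2l; first by apply: exprn_ge0; lra.
exact: sum_edge_energy_le_energy.
Qed.

Lemma Hnorm2E m : Hnorm2 m F =
  (\sum_(w : m.-tuple 'I_3) \int[mu]_(x in Iedge m) \int[mu]_(y in Iedge m)
      (kern (fun x => F (edge w o0 o1 x)) x y)%:E +
   \sum_(w : m.-tuple 'I_3) \int[mu]_(x in Iedge m) \int[mu]_(y in Iedge m)
      (kern (fun x => F (edge w o0 o2 x)) x y)%:E +
   \sum_(w : m.-tuple 'I_3) \int[mu]_(x in Iedge m) \int[mu]_(y in Iedge m)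
      (kern (fun x => F (edge w o1 o2 x)) x y)%:E)%E.
Proof.
exact: (sum_lt_ord3 (fun i j => (\sum_(w : m.-tuple 'I_3)
  \int[mu]_(x in Iedge m) \int[mu]_(y in Iedge m)
    (kern (fun x => F (edge w i j x)) x y)%:E)%E)).
Qed.

Lemma Hnorm2_le_energy m :
  {within @SGm R m, continuous F} -> cvg (Eseq F @ \oo) ->
  (Hnorm2 m F <= (3 * (6400 * 30) * energy F)%:E)%E.
Proof.
move=> cF cE; rewrite Hnorm2E.
have -> : 3 * (6400 * 30) * energy F =
  6400 * (30 * energy F) + 6400 * (30 * energy F) + 6400 * (30 * energy F) by ring.
by rewrite !EFinD; apply: leeD; [apply: leeD|]; exact: sum_integral_kern_le_energy.
Qed.

End EnergyUpper.

(** * Topology of the gasket *)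

Section Gasket.
Variable R : realType.
Variable K : set (pt R).
Hypothesis hK : is_SG K.
Implicit Types (p x : pt R) (w : seq 'I_3).

Lemma gasket_compact : compact K. Proof. by have [] := hK. Qed.

Lemma gasket_closed : closed K.
Proof. by apply: compact_closed gasket_compact; exact: (@norm_hausdorff R (R * R)%type). Qed.

Lemma gasket_Phi i x : K x -> K (Phi i x).
Proof. by move=> Kx; have [_ [_ ->]] := hK; exists i => //; exists x. Qed.

Lemma gasket_Phis w x : K x -> K (Phis w x).
Proof. by move=> Kx; elim: w => //= i w IH; exact: gasket_Phi. Qed.

Lemma gasket_split p : K p -> exists i x, K x /\ Phi i x = p.
Proof.
by have [_ [_ e]] := hK; rewrite {1}e => -[i _ [x Kx xp]]; exists i, x.
Qed.

Lemma gasket_word n p : K p -> exists w, size w = n /\ exists2 x, K x & Phis w x = p.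
Proof.
elim: n p => [|n IH] p Kp; first by exists [::]; split => //; exists p.
have [i [y [Ky <-]]] := gasket_split Kp.
have [w [<- [x Kx <-]]] := IH _ Ky.
by exists (i :: w); split => //; exists x.
Qed.

(** Each half of a side is its image under [Phi i] or [Phi j]. Going back through [n] such halvings
    to an arbitrary point of [K] approximates the given point within [C 2^-n] by points of [K],
    which is closed. *)
Lemma gasket_seg i j t : 0 <= t <= 1 -> K (seg i j t).
Proof.
move=> t01; have [k0 Kk0] : K !=set0 by have [_ []] := hK.
(* Bounds both coordinate distances from any point of the side to [k0]. *)
pose C := `|(q R i).1| + `|(q R j).1 - (q R i).1| + `|k0.1| +
          (`|(q R i).2| + `|(q R j).2 - (q R i).2| + `|k0.2|).
have bnd (a b c s : R) : 0 <= s <= 1 -> `|a + s * b - c| <= `|a| + `|b| + `|c|.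
  move=> /andP[s0 s1]; apply: le_trans (ler_normB _ _) _; rewrite lerD2r.
  apply: le_trans (ler_normD _ _) _; rewrite lerD2l normrM ger0_norm //.
  by rewrite ler_piMl.
have approx n s : 0 <= s <= 1 -> exists k, [/\ K k,
    `|(seg i j s).1 - k.1| <= C * edgelen R n & `|(seg i j s).2 - k.2| <= C * edgelen R n].
  elim: n s => [|n IH] s s01.
    exists k0; split=> //; rewrite /edgelen expr0 invr1 mulr1 /C.
    - by apply: le_trans (bnd _ _ _ _ s01) _; rewrite lerDl !addr_ge0.
    - by apply: le_trans (bnd _ _ _ _ s01) _; rewrite lerDr !addr_ge0.
  have contract a (s' : R) : 0 <= s' <= 1 -> seg i j s = Phi a (seg i j s') ->
      exists k, [/\ K k, `|(seg i j s).1 - k.1| <= C * edgelen R n.+1 &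
        `|(seg i j s).2 - k.2| <= C * edgelen R n.+1].
    move=> s'01 ->; have [k [Kk k1 k2]] := IH _ s'01.
    have half (u v c : R) : `|u - v| <= C * edgelen R n ->
        `|2^-1 * u + c - (2^-1 * v + c)| <= C * edgelen R n.+1.
      have -> : 2^-1 * u + c - (2^-1 * v + c) = (u - v) / 2 by field.
      rewrite normrM (ger0_norm (_ : 0 <= 2^-1)) ?invr_ge0 // edgelenS mulrA => h.
      by rewrite ler_wpM2r // invr_ge0.
    exists (Phi a k); split; [exact: gasket_Phi|exact: half|exact: half].
  have [s2|s2] := leP s (1 / 2).
    apply: (contract i (2 * s)); first by apply/andP; split; lra.
    by rewrite Phi_seg_l; congr seg; field.
  apply: (contract j (2 * s - 1)); first by apply/andP; split; lra.
  by rewrite Phi_seg_r; congr seg; field.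
have [u hu] := choice (fun n => approx n t t01).
have Cc : C * edgelen R n @[n --> \oo] --> 0.
  by rewrite -[X in _ --> X](mulr0 C); apply: cvgMl_tmp; exact: cvg_edgelen.
have near_lim (a : R) (v : nat -> R) :
    (forall n, `|a - v n| <= C * edgelen R n) -> v @ \oo --> a.
  move=> h; apply: (@squeeze_cvgr _ _ _ _ (fun n => a - C * edgelen R n)
    (fun n => a + C * edgelen R n)).
  - apply: nearW => n; have := h n; rewrite ler_distl => /andP[h1 h2].
    by apply/andP; split; lra.
  - by rewrite -[X in _ --> X]subr0; apply: cvgB => //; exact: cvg_cst.
  - by rewrite -[X in _ --> X]addr0; apply: cvgD => //; exact: cvg_cst.
have u1 : (u n).1 @[n --> \oo] --> (seg i j t).1.
  by apply: near_lim => n; have [] := hu n.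
have u2 : (u n).2 @[n --> \oo] --> (seg i j t).2.
  by apply: near_lim => n; have [] := hu n.
have ucvg : u @ \oo --> seg i j t.
  have -> : u = fun n => ((u n).1, (u n).2) by apply/funext => n; case: (u n).
  exact: (cvg_pair u1 u2).
apply: (closed_cvg _ gasket_closed _ _ ucvg).
by apply: nearW => n; have [] := hu n.
Qed.

Lemma SGm_sub_gasket m : @SGm R m `<=` K.
Proof.
move=> _ [w [i [j [ij [x /andP[x0 x1] ->]]]]]; rewrite edgeE.
apply: gasket_Phis; apply: gasket_seg; rewrite mulr_ge0 ?exprn_ge0 //=.
by rewrite mulrC -ler_pdivlMr ?exprn_gt0 // div1r.
Qed.

(* Barycentric coordinates with respect to the triangle [q 0], [q 1], [q 2]. *)
Definition bary (k : 'I_3) p : R :=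
  match nat_of_ord k with
  | 0%N => 1 - p.1 - p.2 / Num.sqrt 3
  | 1%N => p.1 - p.2 / Num.sqrt 3
  | _ => 2 * (p.2 / Num.sqrt 3)
  end.

Lemma sqrt3_neq0 : Num.sqrt 3 != 0 :> R.
Proof. by rewrite gt_eqF // sqrtr_gt0. Qed.

Lemma bary_corner k i : bary k (q R i) = (k == i)%:R.
Proof.
have h : Num.sqrt 3 / 2 / Num.sqrt 3 = 2^-1 :> R by field; exact: sqrt3_neq0.
by case: (ord3_cases k) => ->; case: (ord3_cases i) => ->;
  rewrite /bary /q /= ?h ?mul0r; field.
Qed.

Lemma bary_Phi k i p : bary k (Phi i p) = (bary k p + (k == i)%:R) / 2.
Proof.
rewrite -bary_corner; have s3 := sqrt3_neq0.
by case: (ord3_cases k) => ->; rewrite /bary /Phi /=; field.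
Qed.

Lemma bary_sum p : bary o0 p + bary o1 p + bary o2 p = 1.
Proof. by rewrite /bary /=; ring. Qed.

Lemma bary_inj p x : (forall k, bary k p = bary k x) -> p = x.
Proof.
move=> h; have h1 := h o1; have h2 := h o2; move: h1 h2; rewrite /bary /= => h1 h2.
have e : p.2 / Num.sqrt 3 = x.2 / Num.sqrt 3 by lra.
have e2 : p.2 = x.2 by apply: (mulIf _ e); rewrite invr_eq0 sqrt3_neq0.
rewrite (surjective_pairing p) (surjective_pairing x) e2; congr pair; lra.
Qed.

Lemma continuous_bary k : continuous (bary k).
Proof.
move=> p; have c1 : y.1 @[y --> p] --> p.1 by exact: cvg_fst.
have c2 : y.2 / Num.sqrt 3 @[y --> p] --> p.2 / Num.sqrt 3.
  by apply: cvgMr_tmp; exact: cvg_snd.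
rewrite /bary; case: (nat_of_ord k) => [|[|n]].
- by apply: cvgB => //; apply: cvgB => //; exact: cvg_cst.
- exact: cvgB.
- exact: cvgMl_tmp.
Qed.

(* The minimum [b] of a barycentric coordinate over the gasket satisfies
   [b >= b / 2]. *)
Lemma bary_ge0 k p : K p -> 0 <= bary k p.
Proof.
move=> Kp; have K0 : K !=set0 by exists p.
have [c Kc cmin] := compact_EVT_min K0 gasket_compact
  (continuous_subspaceT (@continuous_bary k)).
apply: le_trans (cmin p _); last by rewrite inE.
rewrite inE in Kc; have [i [x [Kx e]]] := gasket_split Kc.
have := cmin x; rewrite inE => /(_ Kx); rewrite -e bary_Phi.
have : 0 <= (k == i)%:R :> R by exact: ler0n.
lra.
Qed.

(** The coordinates are nonnegative on the gasket and sum to 1, so when one of them reaches 1 the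
    others vanish. *)
Lemma gasket_eq_corner k p : K p -> 1 <= bary k p -> p = q R k.
Proof.
move=> Kp hk; apply: bary_inj => l; rewrite bary_corner.
have := bary_sum p; have := bary_ge0 o0 Kp; have := bary_ge0 o1 Kp.
have := bary_ge0 o2 Kp; move: hk.
by case: (ord3_cases k) => ->; case: (ord3_cases l) => -> /=; lra.
Qed.

Lemma Phi_inj i : injective (@Phi R i).
Proof.
move=> [a b] [c d] [h1 h2]; congr pair; lra.
Qed.

(** In a cell [i] other than [j] the coordinate [j] is halved, so it cannot reach 1. *)
Lemma Phi_eq_corner i j x : K x -> Phi i x = q R j -> i = j /\ x = q R j.
Proof.
move=> Kx e; have := congr1 (bary j) e; rewrite bary_Phi bary_corner eqxx /=.
have [ji|ne] := eqVneq j i => /= h.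
  by rewrite ji; split=> //; rewrite -ji; apply: gasket_eq_corner => //; lra.
have xj : x = q R j by apply: gasket_eq_corner => //; lra.
by exfalso; move: h; rewrite xj bary_corner eqxx /=; lra.
Qed.

Lemma Phis_eq_corner w j x : K x -> Phis w x = q R j -> x = q R j.
Proof.
by move=> Kx; elim: w => //= i w IH /(Phi_eq_corner (gasket_Phis w Kx)) [_ /IH].
Qed.

(** The coordinate [j] is at least 1/2 in the cell [j], while in the cell [i] it is half of the
    coordinate [j] of [x], which is therefore at least 1. *)
Lemma Phi_overlap i j x y : K x -> K y -> i != j -> Phi i x = Phi j y -> x = q R j.
Proof.
move=> Kx Ky ij e; apply: gasket_eq_corner => //.
have := congr1 (bary j) e; rewrite !bary_Phi eqxx eq_sym (negbTE ij) /=.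
have := bary_ge0 j Ky; lra.
Qed.

(** Finite ramification. A common prefix is removed by injectivity; at the first differing letter
    the remaining words send [x] and [y] to corners, and within the gasket a corner is only the
    image of itself. *)
Lemma cells_overlap w v x y : size w = size v -> K x -> K y -> w != v ->
  Phis w x = Phis v y -> exists i j, x = q R i /\ y = q R j.
Proof.
move=> + Kx Ky; elim: w v => [|a w IH] [|b v] //= [sz] ne e.
have [ab|ab] := eqVneq a b.
  apply: (IH v) => //; last by apply: (@Phi_inj a); rewrite e ab.
  by apply: contra ne => /eqP ->; rewrite ab.
have ba : b != a by rewrite eq_sym.
exists b, a; split.
- apply: (@Phis_eq_corner w) => //.
  exact: (Phi_overlap (gasket_Phis w Kx) (gasket_Phis v Ky) ab e).
- apply: (@Phis_eq_corner v) => //.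
  exact: (Phi_overlap (gasket_Phis v Ky) (gasket_Phis w Kx) ba (esym e)).
Qed.

(** The level-[n] cells are finitely many closed sets, so near [p] only those containing [p] are
    met. *)
Lemma near_same_cell p n : K p ->
  \forall y \near p, K y -> exists w, [/\ size w = n, (Phis w @` K) p & (Phis w @` K) y].
Proof.
move=> Kp.
have h (w : n.-tuple 'I_3) : \forall y \near p, (Phis w @` K) y -> (Phis w @` K) p.
  have [wp|wp] := pselect ((Phis w @` K) p);
    first by apply: (@filterS _ _ (nbhs_filter p) setT) => //; exact: filterT.
  have cl : closed (Phis w @` K).
    apply: compact_closed; first exact: (@norm_hausdorff R (R * R)%type).
    apply: continuous_compact gasket_compact.
    exact: continuous_subspaceT (@continuous_Phis R w).
  have := open_nbhs_nbhs (conj (closed_openC cl) wp).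
  by apply: (@filterS _ _ (nbhs_filter p)) => y ny /ny.
have := @filter_forall _ _ _ _ (nbhs_filter p) h.
apply: (@filterS _ _ (nbhs_filter p)) => y hy Ky.
have [w [wn [x Kx xy]]] := gasket_word n Ky.
have wy : (Phis w @` K) y by exists x.
exists w; split=> //.
have sw : size w == n by rewrite wn.
exact: (hy (Tuple sw)).
Qed.

End Gasket.

(** * Extension from the graphs *)

Section EnergyLower.
Variable R : realType.
Variables (m : nat) (F : pt R -> R).
Local Notation mu := (@lebesgue_measure R).
Local Notation edge_integral w i j :=
  (\int[mu]_(x in Iedge m) \int[mu]_(y in Iedge m)
      (kern (fun x => F (edge w i j x)) x y)%:E)%E.

Lemma edge_integral_ge0 (w : m.-tuple 'I_3) i j : (0 <= edge_integral w i j)%E.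
Proof.
apply: integral_ge0 => x _; apply: integral_ge0 => y _.
by rewrite lee_fin kern_ge0.
Qed.

Lemma edge_integral_le_Hnorm2 (w : m.-tuple 'I_3) (i j : 'I_3) : (i < j)%N ->
  (edge_integral w i j <= Hnorm2 m F)%E.
Proof.
have le_sum (a b : 'I_3) :
    (edge_integral w a b <= \sum_(v : m.-tuple 'I_3) edge_integral v a b)%E.
  rewrite (bigD1 w) //=; apply: leeDl; apply: sume_ge0 => v _; exact: edge_integral_ge0.
have sum_ge0 (a b : 'I_3) : (0 <= \sum_(v : m.-tuple 'I_3) edge_integral v a b)%E.
  by apply: sume_ge0 => v _; exact: edge_integral_ge0.
rewrite Hnorm2E; case: (ord3_cases i) => ->; case: (ord3_cases j) => -> //= _.
- apply: le_trans (le_sum _ _) _; rewrite -addeA; apply: leeDl.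
  by apply: adde_ge0; exact: sum_ge0.
- apply: le_trans (le_sum _ _) _; rewrite addeAC; apply: leeDr.
  by apply: adde_ge0; exact: sum_ge0.
- apply: le_trans (le_sum _ _) _; apply: leeDr.
  by apply: adde_ge0; exact: sum_ge0.
Qed.

Lemma vertices_le_edge_integral (w : m.-tuple 'I_3) (i j : 'I_3) (b : R) : i != j ->
  {within @SGm R m, continuous F} -> (edge_integral w i j <= b%:E)%E ->
  (F (Phis w (q R j)) - F (Phis w (q R i))) ^+ 2 <= 160 * (3 / 5) ^+ m * b.
Proof.
move=> ij cF hb.
have := endpoints_le_integral_kern (within_edge_continuous (w := w) ij cF) hb.
by rewrite !edgeE mulr0 seg0 /edgelen mulfV ?seg1.
Qed.

(** 320 is twice the endpoint constant 160, the 2 coming from ordered pairs; [(5/3)^m] cancels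
    against the [(3/5)^m] of the endpoint bound. *)
Lemma Eseq_le_Hnorm2 : {within @SGm R m, continuous F} -> (Hnorm2 m F < +oo)%E ->
  ((Eseq F m)%:E <= 320%:E * Hnorm2 m F)%E.
Proof.
move=> cF Hfin.
have J_fin (w : m.-tuple 'I_3) (i j : 'I_3) : (i < j)%N ->
    edge_integral w i j \is a fin_num.
  move=> ij; rewrite ge0_fin_numE ?edge_integral_ge0 //.
  exact: le_lt_trans (edge_integral_le_Hnorm2 w ij) Hfin.
pose r i j (w : m.-tuple 'I_3) := fine (edge_integral w i j).
have rE (i j : 'I_3) : (i < j)%N -> (\sum_(w : m.-tuple 'I_3) edge_integral w i j)%E =
    (\sum_(w : m.-tuple 'I_3) r i j w)%:E.
  by move=> ij; rewrite -sumEFin; apply: eq_bigr => w _; rewrite fineK // J_fin.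
have vertices (w : m.-tuple 'I_3) (i j : 'I_3) : (i < j)%N ->
    (F (Phis w (q R i)) - F (Phis w (q R j))) ^+ 2 <= 160 * (3 / 5) ^+ m * r i j w.
  move=> ij; rewrite -sqrrN opprB; apply: vertices_le_edge_integral => //.
    by rewrite neq_ltn ij.
  by rewrite /r fineK // J_fin.
have -> : Hnorm2 m F = (\sum_(w : m.-tuple 'I_3) r o0 o1 w +
    \sum_(w : m.-tuple 'I_3) r o0 o2 w + \sum_(w : m.-tuple 'I_3) r o1 o2 w)%:E.
  rewrite Hnorm2E !EFinD; congr (_ + _ + _)%E.
  - exact: (rE o0 o1 isT).
  - exact: (rE o0 o2 isT).
  - exact: (rE o1 o2 isT).
rewrite -EFinM lee_fin.
rewrite EseqE /word_sum -!big_split /=.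
have -> : 320 * \sum_(w : m.-tuple 'I_3) (r o0 o1 w + r o0 o2 w + r o1 o2 w) =
    2 * ((5 / 3) ^+ m * \sum_(w : m.-tuple 'I_3)
      160 * (3 / 5) ^+ m * (r o0 o1 w + r o0 o2 w + r o1 o2 w)).
  have e : 5 / 3 * (3 / 5) = 1 :> R by field.
  rewrite -mulr_sumr; set S := \sum_(w : m.-tuple 'I_3) _.
  have -> : 2 * ((5 / 3) ^+ m * (160 * (3 / 5) ^+ m * S)) =
    320 * S * ((5 / 3) ^+ m * (3 / 5) ^+ m) by ring.
  by rewrite -exprMn e expr1n mulr1.
apply: ler_wpM2l; first by [].
apply: ler_wpM2l; first by apply: exprn_ge0; lra.
apply: ler_sum => w _; rewrite /cell_energy /triple_energy.
move: (vertices w o0 o1 isT) (vertices w o0 o2 isT) (vertices w o1 o2 isT).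
move: (r o0 o1 w) (r o0 o2 w) (r o1 o2 w) ((3 / 5) ^+ m) => x y z t.
move: (F _) (F _) (F _) => a b c; lra.
Qed.

End EnergyLower.

(** Both inequalities are weak, so that [t = 1] belongs to the last cell. *)
Lemma exists_dyadic_cell (R : realType) (t : R) n : 0 <= t <= 1 ->
  exists2 l, (l < 2 ^ n)%N & l%:R <= t * 2 ^+ n <= l.+1%:R.
Proof.
move=> t01; elim: n => [|n [l ln /andP[h1 h2]]].
  by exists 0%N => //; rewrite expr0 mulr1.
rewrite exprS mulrCA; have [h|h] := leP (2 * (t * 2 ^+ n)) l.*2.+1%:R.
  exists l.*2; first by rewrite expnS; lia.
  by rewrite h -muln2 natrM; lra.
exists l.*2.+1; first by rewrite expnS; lia.
by rewrite ltW //= -doubleS -muln2 natrM; lra.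
Qed.

Section Extension.
Variable R : realType.
Variable K : set (pt R).
Hypothesis hK : is_SG K.
Variables (f : nat -> pt R -> R) (B : R).
Hypothesis f_inH : forall m, inH m (f m).
Hypothesis f_bound : forall m, (Hnorm2 m (f m) <= B%:E)%E.
Hypothesis f_consistent : forall m m', (m <= m')%N ->
  forall x, SGm m x -> f m' x = f m x.
Implicit Types (w v : seq 'I_3) (p : pt R).

Lemma vertex_in_SGm w i : SGm (size w) (Phis w (q R i)).
Proof.
have [j ij] : exists j : 'I_3, i != j.
  by case: (ord3_cases i) => ->; [exists o1|exists o0|exists o0].
exists (in_tuple w), i, j; split => //; exists 0; first by rewrite lexx edgelen_ge0.
by rewrite edgeE mulr0 seg0.
Qed.

Lemma bound_nonneg : 0 <= B.
Proof.
rewrite -lee_fin; apply: le_trans (f_bound 0).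
apply: le_trans (edge_integral_le_Hnorm2 (f 0) (in_tuple [::]) (isT : (o0 < o1)%N)).
exact: edge_integral_ge0.
Qed.

Let r5 n : 0 <= (3 / 5) ^+ n :> R.
Proof. by apply: exprn_ge0; lra. Qed.

Lemma vertices_close w i j :
  (f (size w) (Phis w (q R j)) - f (size w) (Phis w (q R i))) ^+ 2 <=
  160 * (3 / 5) ^+ size w * B.
Proof.
have ordered (a b : 'I_3) : (a < b)%N ->
    (f (size w) (Phis w (q R b)) - f (size w) (Phis w (q R a))) ^+ 2 <=
    160 * (3 / 5) ^+ size w * B.
  move=> ab; have ne : a != b by rewrite neq_ltn ab.
  apply: (vertices_le_edge_integral (w := in_tuple w) ne).
    by have [] := f_inH (size w).
  exact: le_trans (edge_integral_le_Hnorm2 _ _ ab) (f_bound _).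
have [/ordered//|ji|/val_inj ->] := ltngtP i j.
  by rewrite -sqrrN opprB; exact: ordered.
by rewrite subrr expr0n /=; have := r5 (size w); have := bound_nonneg; nra.
Qed.

Definition corner_value w := f (size w) (Phis w (q R o0)).

(** Since [Phi a (q 0) = Phi 0 (q a)], the corner of the child [a] is the vertex [a] of the child 0,
    whose vertex 0 is the corner of [w]. So both points are vertices of one cell of the finer level,
    and consistency links the two levels of [f]. *)
Lemma corner_value_child w a :
  (corner_value (rcons w a) - corner_value w) ^+ 2 <= 160 * (3 / 5) ^+ (size w).+1 * B.
Proof.
have := vertices_close (rcons w o0) o0 a.
rewrite /corner_value !Phis_rcons !size_rcons Phi_fix (Phi_sym R a o0).
by rewrite (f_consistent (leqnSn (size w)) (vertex_in_SGm w o0)).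
Qed.

(** The constant solves [C = 4 * 96 + 4/3 * 3/5 * C], where [96 = 160 * 3/5] comes from the first
    letter and [3/5 * C] from the remaining ones, combined with the weights 4 and 4/3. *)
Lemma corner_value_descendant w v :
  (corner_value (w ++ v) - corner_value w) ^+ 2 <= 1920 * (3 / 5) ^+ size w * B.
Proof.
elim: v w => [|a v IH] w.
  rewrite cats0 subrr expr0n /=; have := r5 (size w); have := bound_nonneg; nra.
have h1 := corner_value_child w a; have h2 := IH (rcons w a).
move: h1 h2; rewrite cat_rcons size_rcons (exprS _ (size w)).
have : 0 <= (3 / 5) ^+ size w * B by rewrite mulr_ge0 ?bound_nonneg.
set x := corner_value (w ++ a :: v); set y := corner_value (rcons w a).
set z := corner_value w.
rewrite -!mulrA; set T := _ ^+ size w * B => T0 h1 h2.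
have := sqr_ge0 (3 * (y - z) - (x - y)); nra.
Qed.

(** Distinct cells of one level meet only at a common vertex, which is compared with both corners:
    [2 * (160 + 160) = 640]. *)
Lemma corner_value_same_point w v x y : size w = size v -> K x -> K y ->
  Phis w x = Phis v y ->
  (corner_value w - corner_value v) ^+ 2 <= 640 * (3 / 5) ^+ size w * B.
Proof.
move=> sz Kx Ky e; have T0 : 0 <= (3 / 5) ^+ size w * B by rewrite mulr_ge0 ?bound_nonneg.
have [<-|ne] := eqVneq w v.
  by rewrite subrr expr0n /= -mulrA; lra.
have [i [j [xi yj]]] := cells_overlap hK sz Kx Ky ne e.
have h1 := vertices_close w i o0; have h2 := vertices_close v j o0.
move: h1 h2; rewrite -xi -yj -e -!sz /corner_value -sz.
set a := f _ _; set b := f _ (Phis w x); set c := f _ _.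
rewrite -!mulrA; set T := _ ^+ size w * B => h1 h2.
have := sqr_ge0 ((a - b) + (c - b)); nra.
Qed.

(** The prefix of [v] of the length of [w] addresses the same point, so the two previous bounds
    combine: [2 * (1920 + 640) = 5120]. *)
Lemma corner_value_point w v x y : (size w <= size v)%N -> K x -> K y ->
  Phis w x = Phis v y ->
  (corner_value v - corner_value w) ^+ 2 <= 5120 * (3 / 5) ^+ size w * B.
Proof.
move=> sz Kx Ky e; set u := take (size w) v.
have su : size u = size w by rewrite size_takel.
have vE : v = u ++ drop (size w) v by rewrite cat_take_drop.
have h1 := corner_value_descendant u (drop (size w) v).
have Ky' : K (Phis (drop (size w) v) y) by exact: gasket_Phis.
have h2 : (corner_value w - corner_value u) ^+ 2 <= 640 * (3 / 5) ^+ size w * B.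
  by apply: (corner_value_same_point _ Kx Ky') => //; rewrite e {1}vE Phis_cat.
move: h1 h2; rewrite -vE su -!mulrA; set T := _ ^+ size w * B.
set a := corner_value v; set b := corner_value u; set c := corner_value w => h1 h2.
have := sqr_ge0 ((a - b) + (c - b)); nra.
Qed.

Definition modulus n : R := Num.sqrt (5120 * B) * Num.sqrt (3 / 5) ^+ n.

Lemma modulus_ge0 n : 0 <= modulus n.
Proof. by rewrite mulr_ge0 ?exprn_ge0 ?sqrtr_ge0. Qed.

Lemma sqr_modulus n : modulus n ^+ 2 = 5120 * (3 / 5) ^+ n * B.
Proof.
have h : 0 <= 5120 * B by apply: mulr_ge0; [lra|exact: bound_nonneg].
rewrite /modulus exprMn sqr_sqrtr // -exprM mulnC exprM sqr_sqrtr; last lra.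
by ring.
Qed.

Lemma le_modulus n a : a ^+ 2 <= 5120 * (3 / 5) ^+ n * B -> `|a| <= modulus n.
Proof.
rewrite -sqr_modulus -[a ^+ 2]real_normK ?num_real // => h.
by rewrite -(@ler_pXn2r _ 2) // nnegrE ?modulus_ge0.
Qed.

Lemma cvg_modulus : modulus n @[n --> \oo] --> (0 : R).
Proof.
rewrite -[X in _ --> X](mulr0 (Num.sqrt (5120 * B))); apply: cvgMl_tmp.
apply: cvg_expr; rewrite ger0_norm ?sqrtr_ge0 //.
by rewrite -[ltRHS](@sqrtr1 R) ltr_sqrt; lra.
Qed.

Lemma cell_word_exists : exists W : nat -> pt R -> seq 'I_3, forall n p, K p ->
  size (W n p) = n /\ exists2 x, K x & Phis (W n p) x = p.
Proof.
have h (np : nat * pt R) : exists w, K np.2 ->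
    size w = np.1 /\ exists2 x, K x & Phis w x = np.2.
  have [Kp|nKp] := pselect (K np.2); last by exists [::].
  by have [w hw] := gasket_word hK np.1 Kp; exists w.
have [W hW] := choice h.
by exists (fun n p => W (n, p)) => n p; exact: (hW (n, p)).
Qed.

(* The intervals [corner_value (W n p) +/- modulus n] pairwise intersect, so the
   supremum of the left endpoints lies in all of them. *)
Lemma extension_exists : exists F : pt R -> R, forall p w x,
  K x -> Phis w x = p -> `|F p - corner_value w| <= 2 * modulus (size w).
Proof.
have [W hW] := cell_word_exists.
pose lo p n := corner_value (W n p) - modulus n.
exists (fun p => sup (range (lo p))) => p w x Kx wp.
have Kp : K p by rewrite -wp; exact: gasket_Phis.
(* [w] is an arbitrary address of [p], unrelated to the chosen [W]. The shorter of the two words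
   sets the error: [modulus n] is already subtracted in [lo], and [modulus (size w)] is on the
   right. *)
have up n : lo p n <= corner_value w + modulus (size w).
  have [sW [y Ky yp]] := hW n p Kp.
  have e : Phis w x = Phis (W n p) y by rewrite wp yp.
  have [nw|wn] := leqP n (size w).
    have := corner_value_point (_ : (size (W n p) <= size w)%N) Ky Kx (esym e).
    rewrite sW => /(_ nw) /le_modulus h; rewrite ler_distl in h.
    have /andP[h1 h2] := h; rewrite /lo.
    by have := modulus_ge0 (size w); have := modulus_ge0 n; lra.
  have := corner_value_point (_ : (size w <= size (W n p))%N) Kx Ky e.
  rewrite sW => /(_ (ltnW wn)) /le_modulus h; rewrite ler_distl in h.
  have /andP[h1 h2] := h; rewrite /lo.
  by have := modulus_ge0 n; lra.
have ub : ubound (range (lo p)) (corner_value w + modulus (size w)).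
  by move=> _ [n _ <-].
have hs : has_sup (range (lo p)).
  by split; [exists (lo p 0%N), 0%N|exists (corner_value w + modulus (size w))].
have sup_le : sup (range (lo p)) <= corner_value w + modulus (size w).
  by apply: ge_sup => //; case: hs.
have le_sup : lo p (size w) <= sup (range (lo p)).
  by apply: ub_le_sup; [case: hs|exists (size w)].
have [sW [y Ky yp]] := hW (size w) p Kp.
have e : Phis w x = Phis (W (size w) p) y by rewrite wp yp.
have := corner_value_point (_ : (size w <= size (W (size w) p))%N) Kx Ky e.
rewrite sW leqnn => /(_ isT) /le_modulus h; rewrite ler_distl in h.
have /andP[h1 h2] := h; rewrite ler_distl; move: le_sup; rewrite /lo => le_sup.
have m0 := modulus_ge0 (size w); apply/andP; split; lra.
Qed.

(** A point of an edge need not be a vertex of any level. It is approached along its edge by dyadic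
    points sharing a cell with it, where consistency turns [f m] into a vertex value; the error is
    [2 + 1 = 3] moduli, through the corner of that cell. Continuity of [f m] along the edge
    concludes. *)
Lemma extension_restricts (F : pt R -> R) :
  (forall p w x, K x -> Phis w x = p ->
    `|F p - corner_value w| <= 2 * modulus (size w)) ->
  forall m p, SGm m p -> F p = f m p.
Proof.
move=> hF m p [w [i [j [ij [x /andP[x0 x1] pE]]]]].
pose t := 2 ^+ m * x.
have t01 : 0 <= t <= 1.
  rewrite /t mulr_ge0 ?exprn_ge0 //=.
  by rewrite mulrC -ler_pdivlMr ?exprn_gt0 // div1r.
have ex n : exists u, [/\ Iedge m u, x - edgelen R (m + n) <= u <= x &
    `|F p - f m (edge w i j u)| <= 3 * modulus (m + n)].
  have [l ln /andP[l1 l2]] := exists_dyadic_cell n t01.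
  pose v := edge_word i j n l w; pose s := t * 2 ^+ n - l%:R.
  have sv : size v = (m + n)%N by rewrite size_edge_word size_tuple.
  have s01 : 0 <= s <= 1 by rewrite /s -natr1 in l2 *; apply/andP; split; lra.
  have vp : Phis v (seg i j s) = p.
    rewrite pE edgeE Phis_edge_word //; congr (Phis w (seg i j _)).
    by rewrite /s subrK mulfK // expf_neq0 // pnatr_eq0.
  have h1 := hF p v _ (gasket_seg hK i j s01) vp.
  have h2 := vertices_close v i o0.
  have xs : 2 ^+ m * (x - dyad R (m + n) l) * 2 ^+ n = s.
    rewrite /s /t /dyad /edgelen exprD; field.
    by rewrite !expf_neq0 // pnatr_eq0.
  have p2 : 0 < 2 ^+ m * 2 ^+ n :> R by rewrite mulr_gt0 ?exprn_gt0.
  have xs' : (x - dyad R (m + n) l) * (2 ^+ m * 2 ^+ n) = s by rewrite -xs; ring.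
  have ux : dyad R (m + n) l <= x.
    by rewrite -subr_ge0 -(pmulr_lge0 _ p2) xs'; have /andP[] := s01.
  exists (dyad R (m + n) l); split.
  - apply/andP; split; first by rewrite /dyad mulr_ge0 ?edgelen_ge0.
    exact: le_trans ux x1.
  - rewrite ux andbT lerBlDr -lerBlDl /edgelen exprD -[leRHS]mul1r ler_pdivlMr //.
    by rewrite xs'; have /andP[] := s01.
  have uE : f m (edge w i j (dyad R (m + n) l)) = f (size v) (Phis v (q R i)).
    have uS : SGm m (edge w i j (dyad R (m + n) l)).
      exists w, i, j; split => //; exists (dyad R (m + n) l) => //.
      apply/andP; split; first by rewrite /dyad mulr_ge0 ?edgelen_ge0.
      exact: le_trans ux x1.
    rewrite -(f_consistent (leq_addr n m) uS) sv.
    by rewrite edge_dyad_l.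
  have h3 : `|corner_value v - f m (edge w i j (dyad R (m + n) l))| <= modulus (m + n).
    apply: le_modulus; rewrite uE -sv; apply: le_trans h2 _.
    have := bound_nonneg; have := r5 (size v) => r0 b0.
    by rewrite ler_wpM2r // ler_wpM2r //; lra.
  rewrite sv in h1; move: h1 h3; rewrite !ler_norml.
  by move=> /andP[a1 a2] /andP[a3 a4]; apply/andP; split; lra.
have [u hu] := choice ex.
have shift (a : nat -> R) (l : R) : a @ \oo --> l -> a (m + n)%N @[n --> \oo] --> l.
  have -> : (fun n => a (m + n)%N) = [sequence a (n + m)%N]_n.
    by apply/funext => n; rewrite addnC.
  by rewrite cvg_shiftn.
have ux : u @ \oo --> x.
  apply: (@squeeze_cvgr _ _ _ _ (fun n => x - edgelen R (m + n)) (fun=> x)).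
  - by apply: nearW => n; have [] := hu n.
  - rewrite -[X in _ --> X]subr0; apply: cvgB; first exact: cvg_cst.
    exact/shift/cvg_edgelen.
  - exact: cvg_cst.
have gc := within_edge_continuous (w := w) ij (proj1 (f_inH m)).
have Ix : Iedge m x by rewrite /Iedge /= x0.
have gu : f m (edge w i j (u n)) @[n --> \oo] --> f m (edge w i j x).
  by apply: within_continuous_cvg gc Ix _ ux => n; have [] := hu n.
have gF : f m (edge w i j (u n)) @[n --> \oo] --> F p.
  have m0 : 3 * modulus (m + n) @[n --> \oo] --> (0 : R).
    rewrite -[X in _ --> X](mulr0 3); apply: cvgMl_tmp; exact/shift/cvg_modulus.
  apply: (@squeeze_cvgr _ _ _ _ (fun n => F p - 3 * modulus (m + n))
    (fun n => F p + 3 * modulus (m + n))).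
  - apply: nearW => n; have [_ _] := hu n; rewrite ler_norml => /andP[a1 a2].
    by apply/andP; split; lra.
  - by rewrite -[X in _ --> X]subr0; apply: cvgB => //; exact: cvg_cst.
  - by rewrite -[X in _ --> X]addr0; apply: cvgD => //; exact: cvg_cst.
have := cvg_lim (@Rhausdorff R) gF; rewrite (cvg_lim (@Rhausdorff R) gu) => <-.
by rewrite -pE.
Qed.

(** Points of [K] near [p] share a level-[n] cell with [p], and both values lie within
    [2 * modulus n] of its corner value. *)
Lemma extension_continuous (F : pt R -> R) :
  (forall p w x, K x -> Phis w x = p ->
    `|F p - corner_value w| <= 2 * modulus (size w)) ->
  {within K, continuous F}.
Proof.
move=> hF; apply/subspace_continuousP => p Kp; apply/cvgrPdist_le => /= e e0.
have [n hn] : exists n, 4 * modulus n <= e.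
  have e4 : 0 < e / 4 by lra.
  have /cvgr_lt/(_ _ e4)[n _ h] := cvg_modulus.
  by exists n; have := h n (leqnn n); rewrite /=; lra.
have := near_same_cell hK n Kp; apply: (@filterS _ _ (nbhs_filter p)) => y hy Ky.
have [w [wn [x Kx xp] [z Kz zy]]] := hy Ky.
have := hF _ _ _ Kx xp; have := hF _ _ _ Kz zy; rewrite wn !ler_norml.
move=> /andP[a1 a2] /andP[a3 a4]; rewrite /from_subspace.
by apply/andP; split; lra.
Qed.

(** The vertices of level [m] lie on [SGm m], so [Eseq F m] is computed from [f m] alone; a monotone
    bounded sequence converges. *)
Lemma extension_energy (F : pt R -> R) :
  (forall m p, SGm m p -> F p = f m p) ->
  cvg (Eseq F @ \oo) /\
  ((energy F)%:E <= 320%:E * ereal_sup (range (fun m => Hnorm2 m (f m))))%E.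
Proof.
move=> Ff; set S := ereal_sup _.
have S_up m : (Hnorm2 m (f m) <= S)%E by apply: ereal_sup_ubound; exists m.
have SB : (S <= B%:E)%E by apply: ge_ereal_sup => _ [m _ <-]; exact: f_bound.
have EF m : Eseq F m = Eseq (f m) m.
  rewrite !EseqE; congr (_ * (_ * _)); apply: eq_bigr => w _.
  have e i : F (Phis w (q R i)) = f m (Phis w (q R i)).
    by apply: Ff; have := vertex_in_SGm w i; rewrite size_tuple.
  by rewrite /cell_energy !e.
have Sfin : S \is a fin_num.
  rewrite ge0_fin_numE; first exact: le_lt_trans SB (ltry _).
  apply: le_trans (S_up 0%N).
  apply: le_trans (edge_integral_le_Hnorm2 (f 0) (in_tuple [::]) (isT : (o0 < o1)%N)).
  exact: edge_integral_ge0.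
have Ele m : Eseq F m <= 320 * fine S.
  rewrite -lee_fin [leRHS]EFinM fineK // EF.
  apply: le_trans (Eseq_le_Hnorm2 (proj1 (f_inH m)) (proj2 (f_inH m))) _.
  by apply: lee_wpmul2l; [rewrite lee_fin; lra|exact: S_up].
have cE : cvg (Eseq F @ \oo).
  apply: nondecreasing_is_cvgn (@Eseq_nd R F) _.
  by exists (320 * fine S) => _ [m _ <-].
split=> //; rewrite -(fineK Sfin) -EFinM lee_fin.
by apply: limr_le => //; exact: nearW.
Qed.

End Extension.

Unset Implicit Arguments.

Theorem theorem5p3 (R : realType) (K : set (pt R)) (hK : is_SG K) :
  exists c : R, 0 < c /\
  (* (a) *)
  (forall F : pt R -> R, domE K F ->
     (forall m, inH m F) /\
     (ereal_sup (range (fun m => Hnorm2 m F)) <= (c * energy F)%:E)%E) /\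
  (* (b) *)
  (forall f : nat -> pt R -> R,
     (forall m, inH m (f m)) ->
     (exists B : R, forall m, (Hnorm2 m (f m) <= B%:E)%E) ->
     (forall m m', (m <= m')%N -> forall x, SGm m x -> f m' x = f m x) ->
     exists F : pt R -> R, domE K F /\
       (forall m x, SGm m x -> F x = f m x) /\
       ((energy F)%:E <= c%:E * ereal_sup (range (fun m => Hnorm2 m (f m))))%E).
Proof.
(* The sum of the constants of the two halves; the 3 counts the directions of the edges. *)
exists (3 * (6400 * 30) + 320); split; first lra.
split.
- move=> F [cF cE].
  have cSG m : {within @SGm R m, continuous F}.
    by apply: continuous_subspaceW cF; exact: SGm_sub_gasket hK m.
  have E0 : 0 <= energy F.
    have := nondecreasing_cvgn_le (@Eseq_nd R F) cE 0.
    apply: le_trans; rewrite EseqE expr0 mul1r mulr_ge0 //.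
    by apply: word_sum_ge0 => w; exact: cell_energy_ge0.
  have bound m := Hnorm2_le_energy (cSG m) cE.
  split; first by move=> m; split; [exact: cSG|exact: le_lt_trans (bound m) (ltry _)].
  apply: ge_ereal_sup => _ [m _ <-]; apply: le_trans (bound m) _.
  by rewrite lee_fin; apply: ler_wpM2r => //; lra.
- move=> f f_inH [B f_bound] f_cons.
  have [F hF] := extension_exists hK f_inH f_bound f_cons.
  have Ff := extension_restricts hK f_inH f_bound f_cons hF.
  have [cE FE] := extension_energy f_inH f_bound Ff.
  have cF := extension_continuous hK hF.
  exists F; split; first by split.
  split; first exact: Ff.
  (* Enlarging the constant needs a nonnegative supremum, which the norm at level 0 provides. *)
  apply: le_trans FE _; apply: lee_wpmul2r; last by rewrite lee_fin; lra.
  apply: le_trans (ereal_sup_ubound _); last by exists 0%N.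
  apply: le_trans (edge_integral_le_Hnorm2 (f 0) (in_tuple [::]) (isT : (o0 < o1)%N)).
  exact: edge_integral_ge0.
Qed.
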